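(* Let $X$ be a real convex-transitive Banach space, $u\in S_X$, and suppose there is a bicontractive linear projection $P:X\to[u]$. Assume that (i) the set $\omega\text{-}\exp(B_X)$ of weakly exposed points of $B_X$ is norm-dense in $S_X$; and (ii) the set-valued map $u\circ J:(S_X,\omega)\to\mathcal{P}([-1,1])$, $x\mapsto\{g(u): g\in J(x)\}$, is upper semi-continuous at $u$, where $S_X$ carries the relative weak topology. Then $X$ is isometrically a Hilbert space.
   Context: $X$ is convex-transitive if $\overline{\mathrm{conv}}(\{T(y):T\in\mathcal{G}_X\})=B_X$ for every $y\in S_X$, where $\mathcal{G}_X$ is the group of surjective linear isometries. $P$ is bicontractive if $\|P\|\le1$ and $\|I-P\|\le1$. A point $x\in S_X$ is weakly exposed by $f\in S_{X^*}$ if every $(x_n)\subset B_X$ with $f(x_n)\to1$ converges weakly to $x$. The duality map is $J(x)=\{f\in S_{X^*}: f(x)=1\}$. A set-valued map $F$ from a topological space $T$ to subsets of $Y$ is upper semi-continuous at $t$ if for every open $V\supset F(t)$ there is an open neighbourhood $U$ of $t$ with $F(s)\subset V$ for all $s\in U$. *)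

(* Defs.v *)
From Stdlib Require Import Reals List.
Open Scope R_scope.

Record Banach := {
  carrier :> Type;
  zero : carrier;
  add : carrier -> carrier -> carrier;
  opp : carrier -> carrier;
  scal : R -> carrier -> carrier;
  norm : carrier -> R;
  add_assoc : forall x y z, add x (add y z) = add (add x y) z;
  add_comm : forall x y, add x y = add y x;
  add_zero : forall x, add x zero = x;
  add_opp : forall x, add x (opp x) = zero;
  scal_assoc : forall a b x, scal a (scal b x) = scal (a * b) x;
  scal_one : forall x, scal 1 x = x;
  scal_distr_l : forall a x y, scal a (add x y) = add (scal a x) (scal a y);
  scal_distr_r : forall a b x, scal (a + b) x = add (scal a x) (scal b x);
  norm_nonneg : forall x, 0 <= norm x;
  norm_eq_zero : forall x, norm x = 0 -> x = zero;
  norm_scal : forall a x, norm (scal a x) = Rabs a * norm x;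
  norm_triangle : forall x y, norm (add x y) <= norm x + norm y;
  complete : forall s : nat -> carrier,
    (forall eps, 0 < eps -> exists N, forall m n, (N <= m)%nat -> (N <= n)%nat ->
        norm (add (s m) (opp (s n))) < eps) ->
    exists l, forall eps, 0 < eps -> exists N, forall n, (N <= n)%nat ->
        norm (add (s n) (opp l)) < eps
}.

Arguments zero {b0}.
Arguments add {b0}.
Arguments opp {b0}.
Arguments scal {b0}.
Arguments norm {b0}.

Section Defs.
Variable X : Banach.

Definition sub (x y : X) : X := add x (opp y).

Definition ball_X (x : X) : Prop := norm x <= 1.
Definition sphere_X (x : X) : Prop := norm x = 1.

Definition is_linear (T : X -> X) : Prop :=
  (forall x y, T (add x y) = add (T x) (T y)) /\
  (forall a x, T (scal a x) = scal a (T x)).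

Definition is_surj_lin_isometry (T : X -> X) : Prop :=
  is_linear T /\ (forall x, norm (T x) = norm x) /\ (forall y, exists x, T x = y).

Inductive conv (A : X -> Prop) : X -> Prop :=
| conv_in : forall x, A x -> conv A x
| conv_comb : forall x y t, conv A x -> conv A y -> 0 <= t <= 1 ->
    conv A (add (scal t x) (scal (1 - t) y)).

Definition closure (A : X -> Prop) (z : X) : Prop :=
  forall eps, 0 < eps -> exists w, A w /\ norm (sub z w) < eps.

Definition convex_transitive : Prop :=
  forall y, sphere_X y ->
    forall z, closure (conv (fun w => exists T, is_surj_lin_isometry T /\ w = T y)) z
              <-> ball_X z.

Definition is_functional (f : X -> R) : Prop :=
  (forall x y, f (add x y) = f x + f y) /\
  (forall a x, f (scal a x) = a * f x) /\
  (exists C, forall x, Rabs (f x) <= C * norm x).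

Definition dual_sphere (f : X -> R) : Prop :=
  is_functional f /\
  (forall x, ball_X x -> Rabs (f x) <= 1) /\
  (forall eps, 0 < eps -> exists x, ball_X x /\ 1 - eps < Rabs (f x)).

Definition weak_conv (s : nat -> X) (x : X) : Prop :=
  forall f, is_functional f -> Un_cv (fun n => f (s n)) (f x).

Definition weakly_exposed_by (x : X) (f : X -> R) : Prop :=
  sphere_X x /\ dual_sphere f /\
  forall s : nat -> X, (forall n, ball_X (s n)) ->
    Un_cv (fun n => f (s n)) 1 -> weak_conv s x.

Definition weakly_exposed (x : X) : Prop := exists f, weakly_exposed_by x f.

Definition J (x : X) (f : X -> R) : Prop := dual_sphere f /\ f x = 1.

Definition uJ (u x : X) (r : R) : Prop := exists g, J x g /\ r = g u.

Definition weak_open (U : X -> Prop) : Prop :=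
  forall x, U x -> exists (fs : list (X -> R)) (eps : R),
    Forall is_functional fs /\ 0 < eps /\
    forall y, (forall f, In f fs -> Rabs (f y - f x) < eps) -> U y.

End Defs.

Definition R_open (V : R -> Prop) : Prop :=
  forall v, V v -> exists eps, 0 < eps /\ forall w, Rabs (w - v) < eps -> V w.

Definition usc_weak_at (X : Banach) (F : X -> R -> Prop) (t : X) : Prop :=
  forall V, R_open V -> (forall r, F t r -> V r) ->
    exists U, weak_open X U /\ U t /\
      forall s, sphere_X X s -> U s -> forall r, F s r -> V r.

Definition is_hilbert (X : Banach) : Prop :=
  exists ip : X -> X -> R,
    (forall x y, ip x y = ip y x) /\
    (forall x y z, ip (add x y) z = ip x z + ip y z) /\
    (forall a x y, ip (scal a x) y = a * ip x y) /\
    (forall x, 0 <= ip x x) /\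
    (forall x, norm x = sqrt (ip x x)).

(* Main.v *)
Require Import Defs.
From Stdlib Require Import Reals List Lra Lia Psatz Classical ClassicalEpsilon.
From mathcomp Require boolp classical_sets.
Open Scope R_scope.

(** Write [P x = f x * u] and [y x = x - P x], so that [|y x| <= |x|].

    Uniform convexity.  Let [c] be the asymptotic supremum of [|a - b|] over [a], [b] in the
    unit ball with [|a + b| -> 2].  By convex transitivity such a pair can be moved by an
    isometry into any slice of the ball.  Take a weakly exposed point close to [u], exposed by
    [h]: on small slices of [h] the functional [f] is almost constant, and by (ii) all support
    functionals of points of the slice exceed 1/2 at [u].  Let [r] be the asymptotic supremum
    of [|y x|] on these slices.  Moving an extremal pair into a slice of [h + s k], where [k]
    almost norms some [y x0] and vanishes at [u], and projecting it by [y], gives a pair in the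
    ball of radius [r] whose sum is almost of norm [2 r] and whose difference is almost [c];
    hence [c <= r c].  If [c > 0] then [r = 1], and [x0] is almost normed by a functional
    vanishing at [u], contradicting (ii).  So [c = 0].

    Consequently orbits are dense, every unit vector carries a bicontractive projection, and the
    resulting duality form [B] has a symmetric zero set because best approximations are unique.

    Pythagoras.  If there is a third orthogonal vector, the symmetry of the zero set makes
    [a |-> B (x + a e) e / B (x + a e) x] a multiplicative monotone involution up to a constant,
    as in the fundamental theorem of projective geometry; so it is linear, and integrating it
    gives [|x + a e|^2 = 1 + a^2].  In a plane, isometries sending [x] near [e] produce in the
    limit a quarter turn, and the invariance of area under isometries forces a Euclidean norm.
    Then [B] is symmetric, and it is the inner product. *)

Declare Scope vec_scope.
Delimit Scope vec_scope with V.
Bind Scope vec_scope with carrier.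
Notation "x + y" := (add x y) : vec_scope.
Notation "x - y" := (sub _ x y) : vec_scope.
Notation "a * x" := (scal a%R x) : vec_scope.
Notation "`| x |" := (norm x%V) (at level 0, x at level 99, format "`| x |").

(** * Linear combinations *)

Section LinearCombinations.
Context {X : Banach}.
Implicit Types x y : X.

Lemma add_zero_l x : add zero x = x.
Proof. rewrite add_comm; apply add_zero. Qed.

Lemma add_cancel_l x y z : add x y = add x z -> y = z.
Proof.
  intros E.
  assert (F : forall t, add (opp x) (add x t) = t).
  { intros t. rewrite add_assoc, (add_comm _ (opp x)), add_opp. apply add_zero_l. }
  rewrite <- (F y), <- (F z), E. reflexivity.
Qed.

Lemma scal_zero_l x : scal 0 x = zero.
Proof.
  apply (add_cancel_l (scal 0 x)).
  rewrite <- scal_distr_r, add_zero. f_equal; ring.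
Qed.

Lemma scal_zero_r (a : R) : scal a (zero : X) = zero.
Proof.
  apply (add_cancel_l (scal a zero)).
  rewrite <- scal_distr_l, !add_zero. reflexivity.
Qed.

Lemma opp_scal x : opp x = scal (-1) x.
Proof.
  apply (add_cancel_l x). rewrite add_opp.
  transitivity (add (scal 1 x) (scal (-1) x)); [|now rewrite scal_one].
  rewrite <- scal_distr_r. replace (1 + -1) with 0 by ring.
  symmetry; apply scal_zero_l.
Qed.

(** Syntax for vector terms: an identity in a vector space follows once both sides have the same
    real coefficient on each atom, so no normal form of vectors has to be computed. *)
Inductive vexpr :=
| VVar (n : nat) | VZero | VAdd (a b : vexpr) | VOpp (a : vexpr) | VScal (r : R) (a : vexpr).

Fixpoint veval (env : list X) (e : vexpr) : X :=
  match e with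
  | VVar n => nth n env zero
  | VZero => zero
  | VAdd a b => add (veval env a) (veval env b)
  | VOpp a => opp (veval env a)
  | VScal r a => scal r (veval env a)
  end.

Fixpoint vcoef (e : vexpr) (n : nat) : R :=
  match e with
  | VVar m => if Nat.eqb m n then 1 else 0
  | VZero => 0
  | VAdd a b => vcoef a n + vcoef b n
  | VOpp a => - vcoef a n
  | VScal r a => r * vcoef a n
  end.

Fixpoint lin_comb (env : list X) (c : nat -> R) : X :=
  match env with
  | nil => zero
  | x :: l => add (scal (c 0%nat) x) (lin_comb l (fun n => c (S n)))
  end.

(** Recursive rather than a bounded quantifier, so that [cbn] unfolds it into one real equation per
    atom. *)
Fixpoint eq_upto (n : nat) (c d : nat -> R) : Prop :=
  match n with
  | O => True
  | S m => c 0%nat = d 0%nat /\ eq_upto m (fun k => c (S k)) (fun k => d (S k))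
  end.

Lemma lin_comb_ext env : forall c d,
  eq_upto (length env) c d -> lin_comb env c = lin_comb env d.
Proof.
  induction env as [|x l IH]; intros c d; simpl; [reflexivity|].
  intros [H0 H1]. rewrite H0. f_equal. now apply IH.
Qed.

Lemma eq_upto_pointwise n : forall c d, (forall k, c k = d k) -> eq_upto n c d.
Proof. induction n; simpl; auto. Qed.

Lemma lin_comb_zero env : lin_comb env (fun _ => 0) = zero.
Proof.
  induction env as [|x l IH]; simpl; [reflexivity|].
  rewrite IH, scal_zero_l. apply add_zero.
Qed.

Lemma lin_comb_add env : forall c d,
  lin_comb env (fun n => c n + d n) = add (lin_comb env c) (lin_comb env d).
Proof.
  induction env as [|x l IH]; intros c d; simpl; [now rewrite add_zero|].
  rewrite (IH (fun n => c (S n)) (fun n => d (S n))), scal_distr_r, !add_assoc.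
  f_equal. rewrite <- !add_assoc. f_equal. apply add_comm.
Qed.

Lemma lin_comb_scal env r : forall c,
  lin_comb env (fun n => r * c n) = scal r (lin_comb env c).
Proof.
  induction env as [|x l IH]; intros c; simpl; [now rewrite scal_zero_r|].
  rewrite (IH (fun n => c (S n))), scal_distr_l, scal_assoc. reflexivity.
Qed.

Lemma lin_comb_var env : forall m,
  lin_comb env (fun n => if Nat.eqb m n then 1 else 0) = nth m env zero.
Proof.
  induction env as [|x l IH]; intros [|m]; simpl; try reflexivity.
  - rewrite lin_comb_zero, add_zero. apply scal_one.
  - rewrite (IH m), scal_zero_l. apply add_zero_l.
Qed.

Lemma veval_lin_comb env e : veval env e = lin_comb env (vcoef e).
Proof.
  induction e as [n| |a IHa b IHb|a IHa|r a IHa]; simpl.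
  - symmetry; apply lin_comb_var.
  - symmetry; apply lin_comb_zero.
  - rewrite IHa, IHb, <- lin_comb_add. reflexivity.
  - rewrite IHa, opp_scal, <- lin_comb_scal.
    apply lin_comb_ext, eq_upto_pointwise. intros k; ring.
  - rewrite IHa, <- lin_comb_scal. reflexivity.
Qed.

Lemma veval_eq env e1 e2 :
  eq_upto (length env) (vcoef e1) (vcoef e2) -> veval env e1 = veval env e2.
Proof. intros H. rewrite !veval_lin_comb. now apply lin_comb_ext. Qed.

End LinearCombinations.

Ltac v_mem x l :=
  match l with
  | nil => constr:(false)
  | x :: _ => constr:(true)
  | _ :: ?l' => v_mem x l'
  end.

Ltac v_atoms t l :=
  match t with
  | zero => l
  | add ?a ?b => let l' := v_atoms a l in v_atoms b l'
  | opp ?a => v_atoms a l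
  | scal _ ?a => v_atoms a l
  | _ => match v_mem t l with
         | true => l
         | false => constr:(t :: l)
         end
  end.

Ltac v_index x l :=
  match l with
  | x :: _ => constr:(O)
  | _ :: ?l' => let n := v_index x l' in constr:(S n)
  end.

Ltac v_reify t l :=
  match t with
  | zero => constr:(VZero)
  | add ?a ?b => let a' := v_reify a l in let b' := v_reify b l in constr:(VAdd a' b')
  | opp ?a => let a' := v_reify a l in constr:(VOpp a')
  | scal ?r ?a => let a' := v_reify a l in constr:(VScal r a')
  | _ => let n := v_index t l in constr:(VVar n)
  end.

(** The remaining coefficient equations are left to [ring], or to [field] where divisions occur. *)
Ltac vreduce :=
  unfold sub;
  match goal with
  | |- @eq (carrier ?X) ?s ?t =>
      let l0 := v_atoms s (@nil (carrier X)) in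
      let l := v_atoms t l0 in
      let s' := v_reify s l in
      let t' := v_reify t l in
      change (veval l s' = veval l t');
      apply veval_eq; cbn [eq_upto length vcoef Nat.eqb]; repeat split
  end.

Ltac vring := vreduce; ring.

(** * Elementary properties of the norm *)

Section Norm.
Context {X : Banach}.
Implicit Types x y z : X.

Lemma norm_zero : norm (zero : X) = 0.
Proof.
  rewrite <- (scal_zero_l (zero : X)), norm_scal, Rabs_R0. ring.
Qed.

(** The vector identity is a premise, here and in [norm_le_add], so that [vring] can supply it at
    the point of use. *)
Lemma norm_eq_scal x (a : R) y : x = (a * y)%V -> `|x| = Rabs a * `|y|.
Proof. intros ->; apply norm_scal. Qed.

Lemma norm_le_add x y z : x = (y + z)%V -> `|x| <= `|y| + `|z|.
Proof. intros ->; apply norm_triangle. Qed.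

Lemma norm_opp x : norm (opp x) = `|x|.
Proof.
  rewrite (norm_eq_scal (opp x) (-1) x) by vring.
  rewrite Rabs_left by lra. ring.
Qed.

Lemma norm_sub_comm x y : `|x - y| = `|y - x|.
Proof. rewrite <- norm_opp. f_equal. vring. Qed.

Lemma norm_pos x : x <> zero -> 0 < `|x|.
Proof.
  intros H. destruct (Rle_lt_or_eq_dec _ _ (norm_nonneg _ x)) as [h|h]; auto.
  exfalso; apply H, norm_eq_zero; auto.
Qed.

Lemma norm_nonzero x : 0 < `|x| -> x <> zero.
Proof. intros H ->. rewrite norm_zero in H. lra. Qed.

Lemma norm_normalize x : 0 < `|x| -> norm (scal (/ `|x|) x) = 1.
Proof.
  intros H. rewrite norm_scal, Rabs_pos_eq.
  - field; lra.
  - left; now apply Rinv_0_lt_compat.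
Qed.

End Norm.

(** * The Hahn-Banach theorem *)

(** Zorn's lemma [ZL_preorder] speaks of boolean relations; [asbool] carries it over to relations in
    [Prop]. *)
Lemma zorn_preorder (T : Type) (t0 : T) (le : T -> T -> Prop) :
  (forall t, le t t) ->
  (forall r s t, le r s -> le s t -> le r t) ->
  (forall A : T -> Prop, (forall s t, A s -> A t -> le s t \/ le t s) ->
     exists t, forall s, A s -> le s t) ->
  exists t, forall s, le t s -> le s t.
Proof.
  intros Hr Ht Hc.
  destruct (@classical_sets.ZL_preorder T t0 (fun s t => boolp.asbool (le s t)))
    as [t Hmax].
  - intros t. now apply (ssrbool.introT (boolp.asboolP _)).
  - intros r s t H1 H2. apply (ssrbool.introT (boolp.asboolP _)).
    apply (Ht r s t); now apply (ssrbool.elimT (boolp.asboolP _)).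
  - intros A HA. destruct (Hc A) as [t Ht'].
    + intros s t Hs Ht'.
      destruct (HA s t Hs Ht'); [left|right];
        now apply (ssrbool.elimT (boolp.asboolP _)).
    + exists t. intros s Hs. apply (ssrbool.introT (boolp.asboolP _)). auto.
  - exists t. intros s Hs. apply (ssrbool.elimT (boolp.asboolP _)), Hmax.
    now apply (ssrbool.introT (boolp.asboolP _)).
Qed.

Definition is_glb (E : R -> Prop) (m : R) : Prop :=
  (forall r, E r -> m <= r) /\ (forall b, (forall r, E r -> b <= r) -> b <= m).

Lemma glb_exists (E : R -> Prop) (b : R) :
  (exists r, E r) -> (forall r, E r -> b <= r) -> exists m, is_glb E m.
Proof.
  intros [r0 Hr0] Hb.
  destruct (completeness (fun r => E (- r))) as [m [Hm1 Hm2]].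
  - exists (- b). intros r Hr. apply Hb in Hr. lra.
  - exists (- r0). now rewrite Ropp_involutive.
  - exists (- m). split.
    + intros r Hr. assert (- r <= m); [|lra].
      apply Hm1. now rewrite Ropp_involutive.
    + intros c Hc. assert (m <= - c); [|lra].
      apply Hm2. intros r Hr. apply Hc in Hr. lra.
Qed.

Lemma glb_approx (E : R -> Prop) (m eps : R) :
  is_glb E m -> 0 < eps -> exists r, E r /\ r < m + eps.
Proof.
  intros [_ H] He. apply NNPP. intros Hn.
  assert (m + eps <= m); [|lra].
  apply H. intros r Hr. destruct (Rle_lt_dec (m + eps) r); auto.
  exfalso; apply Hn; eauto.
Qed.

Section HahnBanach.
Context {X : Banach}.
Implicit Types x y z : X.

Definition sublinear (q : X -> R) : Prop :=
  (forall x y, q (x + y)%V <= q x + q y) /\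
  (forall a x, 0 <= a -> q (a * x)%V = a * q x).

Lemma sublinear_zero q : sublinear q -> q zero = 0.
Proof.
  intros [_ Hh]. rewrite <- (scal_zero_l (zero : X)), Hh by lra. ring.
Qed.

Lemma sublinear_opp_le q y : sublinear q -> - q (opp y) <= q y.
Proof.
  intros Hq. pose proof (sublinear_zero q Hq) as H0. destruct Hq as [Ha _].
  specialize (Ha y (opp y)). rewrite add_opp, H0 in Ha. lra.
Qed.

(* Homogeneity only has to be checked as an inequality, by scaling back with [/ a]. *)
Lemma sublinear_intro (q : X -> R) :
  q zero = 0 ->
  (forall x y, q (x + y)%V <= q x + q y) ->
  (forall a x, 0 < a -> q (a * x)%V <= a * q x) -> sublinear q.
Proof.
  intros H0 Ha Hh. split; auto.
  intros a x [Hpos|<-].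
  - apply Rle_antisym; auto.
    assert (Hi : 0 < / a) by now apply Rinv_0_lt_compat.
    specialize (Hh (/ a) (a * x)%V Hi).
    replace ((/ a) * (a * x))%V with x in Hh by (vreduce; field; lra).
    apply (Rmult_le_compat_l a) in Hh; [|lra].
    rewrite <- Rmult_assoc, Rinv_r in Hh by lra. lra.
  - rewrite scal_zero_l, H0. ring.
Qed.

(* [slope_values q z y] is the set of the [q (y + t z) - t q z] with [t >= 0]; its infimum
   is the largest sublinear minorant of [q] that is linear along [z]. *)
Definition slope_values (q : X -> R) z y (r : R) : Prop :=
  exists t, 0 <= t /\ r = q (y + t * z)%V - t * q z.

Lemma slope_minorant (q : X -> R) z :
  sublinear q ->
  exists q', sublinear q' /\ (forall y, q' y <= q y) /\ q' (opp z) <= - q z.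
Proof.
  intros Hq. pose proof Hq as [Ha Hh].
  (* Subadditivity at [y + t z] and [- y] bounds the values below, so the infima exist. *)
  assert (Hlow : forall y r, slope_values q z y r -> - q (opp y) <= r).
  { intros y r (t & Ht & ->).
    assert (H := Ha (y + t * z)%V (opp y)).
    replace (add (y + t * z)%V (opp y)) with (t * z)%V in H by vring.
    rewrite (Hh t z Ht) in H. lra. }
  assert (Hex : forall y, exists m, is_glb (slope_values q z y) m).
  { intros y. apply glb_exists with (b := - q (opp y)); auto.
    exists (q y - 0 * q z). exists 0; split; [lra|].
    f_equal. f_equal. vring. }
  pose (q' := fun y => proj1_sig (constructive_indefinite_description _ (Hex y))).
  assert (Hg : forall y, is_glb (slope_values q z y) (q' y))
    by (intros y; unfold q'; now destruct (constructive_indefinite_description _ (Hex y))).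
  assert (Hle : forall y t, 0 <= t -> q' y <= q (y + t * z)%V - t * q z).
  { intros y t Ht. apply (proj1 (Hg y)). now exists t. }
  exists q'. split; [|split].
  - apply sublinear_intro.
    + apply Rle_antisym.
      * specialize (Hle zero 0 (Rle_refl 0)).
        replace (zero + 0 * z)%V with (zero : X) in Hle by vring.
        rewrite (sublinear_zero q) in Hle by auto. lra.
      * apply (proj2 (Hg zero)). intros r Hr. apply Hlow in Hr.
        replace (opp (zero : X)) with (zero : X) in Hr by vring.
        rewrite (sublinear_zero q) in Hr by auto. lra.
    + intros x y. apply le_epsilon. intros eps He.
      destruct (glb_approx _ _ (eps / 2) (Hg x)) as (r1 & (t1 & Ht1 & ->) & H1); [lra|].
      destruct (glb_approx _ _ (eps / 2) (Hg y)) as (r2 & (t2 & Ht2 & ->) & H2); [lra|].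
      assert (H := Hle (x + y)%V (t1 + t2) ltac:(lra)).
      assert (H' := Ha (x + t1 * z)%V (y + t2 * z)%V).
      replace ((x + t1 * z) + (y + t2 * z))%V with ((x + y) + (t1 + t2) * z)%V in H' by vring.
      lra.
    + intros a x Hpos. apply le_epsilon. intros eps He.
      destruct (glb_approx _ _ (eps / a) (Hg x)) as (r1 & (t1 & Ht1 & ->) & H1).
      { now apply Rdiv_lt_0_compat. }
      assert (H := Hle (a * x)%V (a * t1) ltac:(nra)).
      replace ((a * x) + (a * t1) * z)%V with (a * (x + t1 * z))%V in H by vring.
      rewrite Hh in H by lra.
      apply (Rmult_lt_compat_l a) in H1; auto.
      replace (a * (q' x + eps / a)) with (a * q' x + eps) in H1 by (field; lra).
      lra.
  - intros y. specialize (Hle y 0 (Rle_refl 0)).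
    replace (y + 0 * z)%V with y in Hle by vring. lra.
  (* At [t = 1] the vector [- z + t z] vanishes and only [- q z] remains. *)
  - specialize (Hle (opp z) 1 ltac:(lra)).
    replace (opp z + 1 * z)%V with (zero : X) in Hle by vring.
    rewrite (sublinear_zero q) in Hle by auto. lra.
Qed.

(** Zorn's lemma for the reversed pointwise order: a chain is bounded by its pointwise infimum,
    which is finite because every minorant is at least [- p (- y)] at [y]. *)
Lemma minimal_minorant (p : X -> R) :
  sublinear p ->
  exists q, sublinear q /\ (forall y, q y <= p y) /\
    forall q', sublinear q' -> (forall y, q' y <= q y) -> forall y, q y <= q' y.
Proof.
  intros Hp.
  pose (T := {q : X -> R | sublinear q /\ forall y, q y <= p y}).
  pose (le := fun s t : T => forall y, proj1_sig t y <= proj1_sig s y).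
  pose (p0 := exist _ p (conj Hp (fun y => Rle_refl (p y))) : T).
  destruct (zorn_preorder T p0 le) as [[q [Hq Hqp]] Hmax].
  - intros t y; lra.
  - intros r s t H1 H2 y. specialize (H1 y). specialize (H2 y). lra.
  - intros A HA.
    destruct (classic (exists s, A s)) as [[s0 Hs0]|Hne];
      [|exists p0; intros s Hs; exfalso; eauto].
    assert (Hex : forall y, exists m, is_glb (fun r => exists s, A s /\ r = proj1_sig s y) m).
    { intros y. apply glb_exists with (b := - p (opp y)).
      - exists (proj1_sig s0 y). eauto.
      - intros r (s & _ & ->). destruct s as [q [Hq Hqp]]; simpl.
        pose proof (sublinear_opp_le q y Hq). specialize (Hqp (opp y)). lra. }
    pose (m := fun y => proj1_sig (constructive_indefinite_description _ (Hex y))).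
    assert (Hg : forall y, is_glb (fun r => exists s, A s /\ r = proj1_sig s y) (m y))
      by (intros y; unfold m; now destruct (constructive_indefinite_description _ (Hex y))).
    assert (Hle : forall s y, A s -> m y <= proj1_sig s y).
    { intros s y Hs. apply (proj1 (Hg y)). eauto. }
    assert (Hm : sublinear m /\ forall y, m y <= p y).
    { split.
      - apply sublinear_intro.
        + apply Rle_antisym.
          * specialize (Hle s0 zero Hs0). destruct s0 as [q [Hq Hqp]]; simpl in Hle.
            rewrite (sublinear_zero q) in Hle by auto. lra.
          * apply (proj2 (Hg zero)). intros r (s & _ & ->).
            destruct s as [q [Hq Hqp]]; simpl. rewrite (sublinear_zero q) by auto. lra.
        + intros x y. apply le_epsilon. intros eps He.
          destruct (glb_approx _ _ (eps / 2) (Hg x)) as (r1 & (s1 & Hs1 & ->) & H1); [lra|].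
          destruct (glb_approx _ _ (eps / 2) (Hg y)) as (r2 & (s2 & Hs2 & ->) & H2); [lra|].
          (* The smaller of the two functionals almost attains both infima, so its own subadditivity
             suffices. *)
          destruct (HA s1 s2 Hs1 Hs2) as [H|H].
          * specialize (H x). pose proof (Hle s2 (x + y)%V Hs2) as H3.
            destruct s2 as [q [[Ha Hh] Hqp]]; simpl in *. pose proof (Ha x y). lra.
          * specialize (H y). pose proof (Hle s1 (x + y)%V Hs1) as H3.
            destruct s1 as [q [[Ha Hh] Hqp]]; simpl in *. pose proof (Ha x y). lra.
        + intros a x Hpos. apply le_epsilon. intros eps He.
          destruct (glb_approx _ _ (eps / a) (Hg x)) as (r1 & (s1 & Hs1 & ->) & H1).
          { now apply Rdiv_lt_0_compat. }
          pose proof (Hle s1 (a * x)%V Hs1) as H3.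
          destruct s1 as [q [[Ha Hh] Hqp]]; simpl in *.
          rewrite Hh in H3 by lra.
          apply (Rmult_lt_compat_l a) in H1; auto.
          replace (a * (m x + eps / a)) with (a * m x + eps) in H1 by (field; lra).
          lra.
      - intros y. specialize (Hle s0 y Hs0).
        destruct s0 as [q [Hq Hqp]]; simpl in Hle. pose proof (Hqp y). lra. }
    exists (exist _ m Hm). intros s Hs y. simpl. auto.
  - exists q. split; [|split]; auto.
    intros q' Hq' Hle y.
    assert (H' : sublinear q' /\ forall z, q' z <= p z).
    { split; auto. intros z. specialize (Hle z). pose proof (Hqp z). lra. }
    exact (Hmax (exist _ q' H') Hle y).
Qed.

Lemma norm_sublinear : sublinear (norm : X -> R).
Proof.
  split; [apply norm_triangle|].
  intros a x Ha. rewrite norm_scal, Rabs_pos_eq; auto.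
Qed.

(** A minimal sublinear minorant is odd, since otherwise [slope_minorant] would lower it further; an
    odd sublinear functional is linear. *)
Lemma sublinear_majorizes_linear (p : X -> R) :
  sublinear p ->
  exists g : X -> R, (forall x y, g (x + y)%V = g x + g y) /\
    (forall a x, g (a * x)%V = a * g x) /\ (forall x, g x <= p x).
Proof.
  intros Hp. destruct (minimal_minorant p Hp) as (g & Hg & Hgp & Hmin).
  assert (Hopp : forall z, g (opp z) = - g z).
  { intros z. apply Rle_antisym.
    - destruct (slope_minorant g z Hg) as (g' & Hg' & Hle & Hz).
      specialize (Hmin g' Hg' Hle (opp z)). lra.
    - pose proof (sublinear_opp_le g z Hg). lra. }
  exists g. split; [|split]; auto; destruct Hg as [Ha Hh].
  - intros x y. apply Rle_antisym; auto.
    pose proof (Ha (opp x) (opp y)) as H. rewrite !Hopp in H.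
    replace (add (opp x) (opp y)) with (opp (x + y)%V) in H by vring.
    rewrite Hopp in H. lra.
  - intros a x. destruct (Rle_lt_dec 0 a) as [h|h]; auto.
    replace (a * x)%V with (opp ((- a) * x)%V) by vring.
    rewrite Hopp, Hh by lra. ring.
Qed.

(** Lowering the norm along [x] before taking a linear minorant forces [g (- x) <= - |x|], which
    gives the value of [g] at [x]. *)
Theorem hahn_banach x :
  exists g, is_functional X g /\ (forall y, Rabs (g y) <= `|y|) /\ g x = `|x|.
Proof.
  destruct (slope_minorant norm x norm_sublinear) as (p & Hp & Hle & Hx).
  destruct (sublinear_majorizes_linear p Hp) as (g & Ha & Hs & Hgp).
  assert (Hopp : forall y, g (opp y) = - g y).
  { intros y. replace (opp y) with ((-1) * y)%V by vring. rewrite Hs. ring. }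
  assert (Hn : forall y, g y <= `|y|).
  { intros y. specialize (Hgp y). specialize (Hle y). lra. }
  assert (Habs : forall y, Rabs (g y) <= `|y|).
  { intros y. apply Rabs_le. pose proof (Hn (opp y)) as H.
    rewrite Hopp, norm_opp in H. specialize (Hn y). lra. }
  exists g. split; [|split]; auto.
  - split; [|split]; auto. exists 1. intros y. rewrite Rmult_1_l. auto.
  - apply Rle_antisym; auto. specialize (Hgp (opp x)). rewrite Hopp in Hgp. lra.
Qed.

End HahnBanach.

(** * Convex transitivity and uniform convexity *)

Section Functionals.
Context {X : Banach}.
Implicit Types x y z : X.

Lemma functional_sub (g : X -> R) x y : is_functional X g -> g (x - y)%V = g x - g y.
Proof.
  intros (Ha & Hs & _). replace (x - y)%V with (x + (-1) * y)%V by vring.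
  rewrite Ha, Hs. ring.
Qed.

Lemma functional_bound (g : X -> R) :
  is_functional X g -> exists C, 0 < C /\ forall x, Rabs (g x) <= C * `|x|.
Proof.
  intros (_ & _ & C & HC). exists (Rabs C + 1). split.
  - pose proof (Rabs_pos C). lra.
  - intros x. specialize (HC x). pose proof (norm_nonneg _ x).
    pose proof (Rle_abs C). nra.
Qed.

Lemma isometry_sub (T : X -> X) x y :
  is_surj_lin_isometry X T -> T (x - y)%V = (T x - T y)%V.
Proof.
  intros ((Ha & Hs) & _). replace (x - y)%V with (x + (-1) * y)%V by vring.
  rewrite Ha, Hs. vring.
Qed.

(** An upper bound of [phi] on the orbit of [z] passes to the closed convex hull of the orbit, which
    is the whole ball. *)
Lemma convex_transitive_functional (phi : X -> R) z x eps :
  convex_transitive X -> is_functional X phi ->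
  sphere_X X z -> ball_X X x -> 0 < eps ->
  exists T, is_surj_lin_isometry X T /\ phi x - eps < phi (T z).
Proof.
  intros Hct Hphi Hz Hx He. apply NNPP. intros Hn.
  assert (Hall : forall T, is_surj_lin_isometry X T -> phi (T z) <= phi x - eps).
  { intros T HT. apply Rnot_lt_le. intros h. apply Hn. eauto. }
  assert (Hconv : forall w,
    conv X (fun w => exists T, is_surj_lin_isometry X T /\ w = T z) w ->
    phi w <= phi x - eps).
  { intros w Hw. destruct Hphi as (Ha & Hs & _).
    induction Hw as [w (T & HT & ->)|a b t _ IHa _ IHb Ht]; auto.
    rewrite Ha, !Hs. nra. }
  destruct (functional_bound phi Hphi) as (C & HC & Hb).
  destruct (proj2 (Hct z Hz x) Hx (eps / (2 * C))) as (w & Hw & Hd).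
  { apply Rdiv_lt_0_compat; lra. }
  apply Hconv in Hw. specialize (Hb (x - w)%V).
  rewrite functional_sub in Hb by auto.
  apply (Rmult_lt_compat_l C) in Hd; auto.
  replace (C * (eps / (2 * C))) with (eps / 2) in Hd by (field; lra).
  pose proof (Rle_abs (phi x - phi w)). lra.
Qed.

(** The isometry is chosen for the normalized sum of [a] and [b]. It makes [phi (T a) + phi (T b)]
    large, and as neither term exceeds [sigma], each of them is large. *)
Lemma convex_transitive_pair (phi : X -> R) (sigma : R) x a b eps :
  convex_transitive X -> is_functional X phi ->
  (forall y, ball_X X y -> phi y <= sigma) ->
  ball_X X x -> ball_X X a -> ball_X X b -> 0 < `|a + b| -> 0 < eps ->
  exists T, is_surj_lin_isometry X T /\
    `|a + b| * (phi x - eps) - sigma <= phi (T a) /\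
    `|a + b| * (phi x - eps) - sigma <= phi (T b).
Proof.
  intros Hct Hphi Hsig Hx Ha Hb Hab He.
  destruct (convex_transitive_functional phi ((/ `|a + b|) * (a + b))%V x eps)
    as (T & HT & HTz); auto.
  { now apply norm_normalize. }
  exists T. split; auto.
  pose proof HT as ((Tadd & Tscal) & Tnorm & _).
  pose proof Hphi as (Padd & Pscal & _).
  rewrite Tscal, Tadd, Pscal, Padd in HTz.
  assert (HTa : phi (T a) <= sigma) by (apply Hsig; unfold ball_X; rewrite Tnorm; exact Ha).
  assert (HTb : phi (T b) <= sigma) by (apply Hsig; unfold ball_X; rewrite Tnorm; exact Hb).
  apply (Rmult_lt_compat_l `|a + b|) in HTz; auto.
  rewrite <- Rmult_assoc, Rinv_r in HTz by lra.
  lra.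
Qed.

Definition uniformly_convex : Prop :=
  forall eta, 0 < eta -> exists delta, 0 < delta /\
    forall a b : X, `|a| <= 1 -> `|b| <= 1 -> 2 - delta <= `|a + b| -> `|a - b| < eta.

End Functionals.

Arguments uniformly_convex X : clear implicits.

(* [c] is the limit, as [d -> 0], of the supremum of [A d]. *)
Definition asymptotic_sup (A : R -> R -> Prop) (c : R) : Prop :=
  (forall eta d, 0 < eta -> 0 < d -> exists r, A d r /\ c - eta < r) /\
  (forall eta, 0 < eta -> exists d, 0 < d /\ forall r, A d r -> r < c + eta).

(** [c] is the supremum of the levels that [A d] reaches for every [d > 0]. *)
Lemma asymptotic_sup_exists (A : R -> R -> Prop) (m M : R) :
  (forall d, 0 < d -> exists r, A d r /\ m <= r) ->
  (forall d r, 0 < d -> A d r -> r <= M) ->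
  exists c, m <= c /\ asymptotic_sup A c.
Proof.
  intros Hm HM.
  destruct (completeness (fun s => forall d, 0 < d -> exists r, A d r /\ s <= r))
    as [c [Hc1 Hc2]].
  - exists M. intros s Hs. destruct (Hs 1 Rlt_0_1) as (r & Hr & Hle).
    apply HM in Hr; lra.
  - exists m. exact Hm.
  - exists c. split; [now apply Hc1|split].
    + intros eta d He Hd. apply NNPP. intros Hn.
      assert (c <= c - eta); [|lra]. apply Hc2. intros s Hs.
      apply Rnot_lt_le. intros h. destruct (Hs d Hd) as (r & Hr & Hle).
      apply Hn. exists r. split; [auto|lra].
    + intros eta He. apply NNPP. intros Hn.
      assert (c + eta <= c); [|lra]. apply Hc1. intros d Hd.
      apply NNPP. intros Hn'. apply Hn. exists d. split; auto.
      intros r Hr. apply Rnot_le_lt. intros h. apply Hn'. eauto.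
Qed.

(** * Uniform convexity from the slices of one functional *)

Section UniformConvexity.
Context {X : Banach} (u : X) (f h : X -> R).
Hypothesis Hct : convex_transitive X.
Hypothesis Hu : `|u| = 1.
Hypothesis Hf : is_functional X f.
Hypothesis Hfu : forall x, `|x - f x * u| <= `|x|.
Hypothesis Hfu1 : f u = 1.
Hypothesis Hh : is_functional X h.
Hypothesis Hh1 : forall x, `|x| <= 1 -> h x <= 1.
Hypothesis Hslice : forall d, 0 < d -> exists x, `|x| <= 1 /\ 1 - d <= h x.
Hypothesis Hosc : forall eta, 0 < eta -> exists d, 0 < d /\
  forall a b, `|a| <= 1 -> `|b| <= 1 -> 1 - d <= h a -> 1 - d <= h b ->
    Rabs (f a - f b) <= eta.
Variable d0 : R.
Hypothesis Hd0 : 0 < d0.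
Hypothesis Hfhalf : forall x, `|x| <= 1 -> 1 - d0 <= h x -> 1 / 2 <= f x.
Hypothesis HJhalf : forall x g, `|x| = 1 -> 1 - d0 <= h x -> J X x g -> 1 / 2 < g u.

Let y (x : X) : X := (x - f x * u)%V.

(** The asymptotic suprema of [pair_gap] and [slice_width] are the numbers [c] and [r] of the
    overview. *)
Let pair_gap (d r : R) : Prop :=
  exists a b : X, `|a| <= 1 /\ `|b| <= 1 /\ 2 - d <= `|a + b| /\ r = `|a - b|.

Let slice_width (d r : R) : Prop :=
  exists x : X, `|x| <= 1 /\ 1 - d <= h x /\ r = `|y x|.

Lemma residual_diff a b : `|a - b| <= `|y a - y b| + Rabs (f a - f b).
Proof.
  pose proof (norm_le_add (a - b) (y a - y b) ((f a - f b) * u) ltac:(unfold y; vring)) as H.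
  rewrite (norm_scal _ (f a - f b) u), Hu in H. lra.
Qed.

(** An extremal pair moved into a slice of [h] has almost equal values of [f], so its difference is
    almost the difference of two residuals. This later gives [r > 0] when [c > 0]. *)
Lemma gap_le_twice_width c r :
  asymptotic_sup pair_gap c -> asymptotic_sup slice_width r -> c <= 2 * r.
Proof.
  intros [Hc _] [_ Hr]. apply Rnot_lt_le. intros Hlt.
  set (eta := (c - 2 * r) / 8). assert (He : 0 < eta) by (unfold eta; lra).
  destruct (Hr eta He) as (d1 & Hd1 & Hr1).
  destruct (Hosc eta He) as (d2 & Hd2 & Hf2).
  (* The images of [a] and [b] lie in the slice of depth [5 d], since
     [(2 - d) (1 - 2 d) - 1 >= 1 - 5 d]. *)
  set (d := Rmin 1 (Rmin d1 d2) / 5).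
  assert (Hd : 0 < d /\ 5 * d <= 1 /\ 5 * d <= d1 /\ 5 * d <= d2).
  { unfold d. pose proof (Rmin_l 1 (Rmin d1 d2)). pose proof (Rmin_r 1 (Rmin d1 d2)).
    pose proof (Rmin_l d1 d2). pose proof (Rmin_r d1 d2).
    assert (0 < Rmin 1 (Rmin d1 d2)) by (repeat apply Rmin_glb_lt; lra). lra. }
  destruct (Hc eta d He) as (r0 & (a & b & Ha & Hb & Hab & ->) & Hgap); [lra|].
  destruct (Hslice d) as (x & Hx & Hhx); [lra|].
  destruct (convex_transitive_pair h 1 x a b d) as (T & HT & HTa & HTb); auto; try lra.
  pose proof HT as (_ & Tnorm & _).
  assert (Hlow : 1 - 5 * d <= `|a + b| * (h x - d) - 1) by nra.
  assert (Ga : `|y (T a)| < r + eta).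
  { apply Hr1. exists (T a). rewrite Tnorm. repeat split; auto; lra. }
  assert (Gb : `|y (T b)| < r + eta).
  { apply Hr1. exists (T b). rewrite Tnorm. repeat split; auto; lra. }
  assert (Gf : Rabs (f (T a) - f (T b)) <= eta).
  { apply Hf2; rewrite ?Tnorm; auto; lra. }
  pose proof (residual_diff (T a) (T b)) as Hres.
  pose proof (norm_le_add (y (T a) - y (T b)) (y (T a)) (opp (y (T b))) eq_refl) as H1.
  rewrite norm_opp in H1.
  rewrite <- isometry_sub, Tnorm in Hres by auto.
  unfold eta in *. lra.
Qed.

(** On a slice of [phi = h + s k y] the residuals are almost normed by [k] with value [r]. Divided
    by [r + eta], the residuals of a moved extremal pair have a sum of norm almost 2, so the bound
    [c + eta1] applies to them; the difference of the [f] parts costs one [eta]. *)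
Lemma width_bound c r eta1 eta :
  asymptotic_sup pair_gap c -> asymptotic_sup slice_width r ->
  0 < r < 1 -> 0 < eta -> eta <= 1 / 8 -> 0 < eta1 ->
  (forall a b : X, `|a| <= 1 -> `|b| <= 1 -> 2 - 18 * eta / r <= `|a + b| ->
     `|a - b| < c + eta1) ->
  c - eta < (c + eta1) * (r + eta) + eta.
Proof.
  intros [Hc _] [Hr Hr'] Hr01 He He8 He1 Hmod.
  destruct (Hr' eta He) as (d1 & Hd1 & Hr1).
  destruct (Hosc eta He) as (d2 & Hd2 & Hf2).
  set (d := Rmin 1 (Rmin d1 d2)).
  assert (Hd : 0 < d /\ d <= 1 /\ d <= d1 /\ d <= d2).
  { unfold d. pose proof (Rmin_l 1 (Rmin d1 d2)). pose proof (Rmin_r 1 (Rmin d1 d2)).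
    pose proof (Rmin_l d1 d2). pose proof (Rmin_r d1 d2).
    assert (0 < Rmin 1 (Rmin d1 d2)) by (repeat apply Rmin_glb_lt; lra). lra. }
  (* [k y] is at most 1 on the ball, so a point outside the slice of depth [d = 2 s] loses more
     through [h] than [s k y] can restore. *)
  set (s := d / 2). assert (Hs : 0 < s /\ 2 * s = d) by (unfold s; lra).
  assert (Hse : 0 < s * eta) by nra.
  destruct (Hr eta (s * eta) He Hse) as (r0 & (x0 & Hx0 & Hhx0 & ->) & Hyx0).
  destruct (hahn_banach (y x0)) as (k & Hk & Hkn & Hkx).
  assert (Hk' : forall x, `|x| <= 1 -> k (y x) <= `|y x| /\ `|y x| <= 1).
  { intros x Hx. specialize (Hkn (y x)). pose proof (Rle_abs (k (y x))).
    specialize (Hfu x). fold (y x) in Hfu. lra. }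
  set (phi := fun x => h x + s * k (y x)).
  pose proof Hf as (Fadd & Fscal & _). pose proof Hh as (Hadd & Hscal & _).
  pose proof Hk as (Kadd & Kscal & _).
  assert (Yadd : forall p q, y (p + q)%V = (y p + y q)%V)
    by (intros p q; unfold y; rewrite Fadd; vring).
  assert (Yscal : forall t q, y (t * q)%V = (t * y q)%V)
    by (intros t q; unfold y; rewrite Fscal; vring).
  assert (Hphi : is_functional X phi).
  { split; [|split].
    - intros p q. unfold phi. rewrite Yadd, Hadd, Kadd. ring.
    - intros t q. unfold phi. rewrite Yscal, Hscal, Kscal. ring.
    - destruct (functional_bound h Hh) as (C & HC & HCb). exists (C + s). intros q.
      unfold phi. eapply Rle_trans; [apply Rabs_triang|].
      rewrite Rabs_mult, (Rabs_pos_eq s) by lra.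
      specialize (HCb q). specialize (Hkn (y q)). specialize (Hfu q). fold (y q) in Hfu.
      nra. }
  set (sigma := 1 + s * (r + eta)).
  assert (Hsig : forall x, ball_X X x -> phi x <= sigma).
  { intros x Hx. unfold ball_X in Hx. unfold phi, sigma.
    destruct (Hk' x Hx) as [K1 K2]. pose proof (Hh1 x Hx) as Hhx.
    destruct (Rle_lt_dec (1 - d) (h x)) as [hx|hx].
    - assert (`|y x| < r + eta) by (apply Hr1; exists x; repeat split; auto; lra).
      nra.
    - nra. }
  (* [x0] misses [sigma] by at most [s eta] in [h] and [2 s eta] in [s k y]; the last [s eta] is the
     error of convex transitivity. *)
  assert (Hx0low : sigma - 4 * (s * eta) <= phi x0 - s * eta).
  { unfold sigma, phi. rewrite Hkx. nra. }
  destruct (Hc eta (s * eta / 2) He) as (r0 & (a & b & Ha & Hb & Hab & ->) & Hgap); [lra|].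
  assert (Hs1 : s * eta <= 1 / 16) by nra.
  destruct (convex_transitive_pair phi sigma x0 a b (s * eta))
    as (T & HT & HTa & HTb); auto; try lra.
  pose proof HT as (_ & Tnorm & _).
  assert (Hq : 1 / 2 <= sigma - 4 * (s * eta) <= 2) by (unfold sigma; nra).
  (* The bound is [2 (sigma - 4 s eta) - s eta - sigma = sigma - 9 s eta], and [sigma] contains one
     [s eta]. *)
  assert (Hlow : 1 + s * (r - 8 * eta) <= `|a + b| * (phi x0 - s * eta) - sigma).
  { assert (2 * (sigma - 4 * (s * eta)) - s * eta <= `|a + b| * (phi x0 - s * eta)) by nra.
    unfold sigma in *. lra. }
  assert (Hpt : forall p, `|p| <= 1 -> 1 + s * (r - 8 * eta) <= phi p ->
            1 - d <= h p /\ r - 8 * eta <= k (y p) /\ `|y p| < r + eta).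
  { intros p Hp Hpp. unfold phi in Hpp. destruct (Hk' p Hp) as [K1 K2].
    pose proof (Hh1 p Hp) as Hhp.
    assert (A1 : 1 - d <= h p) by nra.
    split; [auto|split].
    - apply (Rmult_le_reg_l s); lra.
    - apply Hr1. exists p. repeat split; auto; lra. }
  destruct (Hpt (T a)) as (Pa1 & Pa2 & Pa3); [rewrite Tnorm; auto|lra|].
  destruct (Hpt (T b)) as (Pb1 & Pb2 & Pb3); [rewrite Tnorm; auto|lra|].
  assert (Hre : 0 < / (r + eta)) by (apply Rinv_0_lt_compat; lra).
  assert (Hball : forall p, `|y p| < r + eta -> `|(/ (r + eta)) * y p| <= 1).
  { intros p Hp. rewrite norm_scal, Rabs_pos_eq by lra.
    apply (Rmult_le_reg_l (r + eta)); [lra|].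
    rewrite <- Rmult_assoc, Rinv_r by lra. lra. }
  assert (Hm : `|(/ (r + eta)) * y (T a) - (/ (r + eta)) * y (T b)| < c + eta1).
  { apply Hmod; auto.
    apply Rle_trans with (k ((/ (r + eta)) * y (T a) + (/ (r + eta)) * y (T b))%V).
    - rewrite Kadd, !Kscal.
      apply Rle_trans with (/ (r + eta) * (2 * (r - 8 * eta))); [|nra].
      (* The 18 is twice the distance 9 [eta] between [r - 8 eta] and [r + eta]. *)
      replace (/ (r + eta) * (2 * (r - 8 * eta))) with (2 - 18 * eta / (r + eta))
        by (field; lra).
      assert (18 * eta / (r + eta) <= 18 * eta / r); [|lra].
      unfold Rdiv. apply Rmult_le_compat_l; [lra|]. apply Rinv_le_contravar; lra.
    - eapply Rle_trans; [apply Rle_abs|apply Hkn]. }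
  rewrite (norm_eq_scal _ (/ (r + eta)) (y (T a) - y (T b))) in Hm by vring.
  rewrite Rabs_pos_eq in Hm by lra.
  apply (Rmult_lt_compat_l (r + eta)) in Hm; [|lra].
  rewrite <- Rmult_assoc, Rinv_r in Hm by lra.
  assert (Gf : Rabs (f (T a) - f (T b)) <= eta).
  { apply Hf2; rewrite ?Tnorm; auto; lra. }
  pose proof (residual_diff (T a) (T b)) as Hres.
  rewrite <- isometry_sub, Tnorm in Hres by auto.
  lra.
Qed.

(** With vanishing errors [width_bound] becomes [c <= c r]. *)
Lemma width_ge_one c r :
  asymptotic_sup pair_gap c -> asymptotic_sup slice_width r -> 0 < c -> 1 <= r.
Proof.
  intros Hc Hr Hc0. apply Rnot_lt_le. intros Hr1.
  pose proof (gap_le_twice_width c r Hc Hr) as Hr0.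
  set (gap := c * (1 - r)). assert (Hgap : 0 < gap) by (unfold gap; nra).
  set (eta1 := gap / 4).
  destruct (proj2 Hc eta1) as (dc & Hdc & Hmod); [unfold eta1; lra|].
  (* The first two bounds serve [width_bound] and its modulus; the third keeps the [eta] errors
     below a quarter of [gap], as [eta1] does for its own. *)
  set (eta := Rmin (Rmin (1 / 8) (r * dc / 18)) (gap / (4 * (c + eta1 + 3)))).
  assert (Hden : 0 < 4 * (c + eta1 + 3)) by (unfold eta1; lra).
  assert (P1 : 0 < gap / (4 * (c + eta1 + 3))) by now apply Rdiv_lt_0_compat.
  assert (P2 : 0 < r * dc / 18) by nra.
  assert (He : 0 < eta) by (unfold eta; repeat apply Rmin_glb_lt; lra).
  assert (E1 : eta <= 1 / 8)
    by (unfold eta; eapply Rle_trans; [apply Rmin_l|apply Rmin_l]).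
  assert (E2 : eta <= r * dc / 18)
    by (unfold eta; eapply Rle_trans; [apply Rmin_l|apply Rmin_r]).
  assert (E3 : eta <= gap / (4 * (c + eta1 + 3))) by (unfold eta; apply Rmin_r).
  assert (E3' : eta * (c + eta1 + 3) <= gap / 4).
  { apply (Rmult_le_compat_r (c + eta1 + 3)) in E3; [|lra].
    replace (gap / (4 * (c + eta1 + 3)) * (c + eta1 + 3)) with (gap / 4) in E3
      by (field; lra). exact E3. }
  assert (H := width_bound c r eta1 eta Hc Hr ltac:(lra) He E1 ltac:(unfold eta1; lra)).
  assert (H' : c - eta < (c + eta1) * (r + eta) + eta).
  { apply H. intros a b Ha Hb Hab. apply Hmod. exists a, b. repeat split; auto.
    eapply Rle_trans; [|exact Hab].
    assert (18 * eta / r <= dc); [|lra].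
    apply (Rmult_le_reg_l r); [lra|]. replace (r * (18 * eta / r)) with (18 * eta) by (field; lra).
    lra. }
  unfold eta1, gap in *. nra.
Qed.

(* Moving [x0] a little along [y x0] gives a point of the slice all of whose support
   functionals almost norm [y x0], hence almost vanish at [u]. *)
Lemma width_lt_one r : asymptotic_sup slice_width r -> r < 1.
Proof.
  intros [Hr _]. apply Rnot_le_lt. intros Hr1.
  set (t := Rmin 1 (d0 / 3)).
  assert (Ht : 0 < t <= 1 /\ 3 * t <= d0).
  { unfold t. pose proof (Rmin_l 1 (d0 / 3)). pose proof (Rmin_r 1 (d0 / 3)).
    assert (0 < Rmin 1 (d0 / 3)) by (apply Rmin_glb_lt; lra). lra. }
  set (kap := t / 8).
  destruct (Hr kap kap) as (r0 & (x0 & Hx0 & Hhx0 & ->) & Hyx0);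
    [unfold kap; lra|unfold kap; lra|].
  set (x1 := (x0 + t * y x0)%V).
  pose proof Hf as (Fadd & Fscal & _). pose proof Hh as (Hadd & Hscal & _).
  assert (Hfy : f (y x0) = 0).
  { unfold y. rewrite functional_sub, Fscal, Hfu1 by auto. ring. }
  assert (Hyx : `|y x0| <= `|x0|) by apply Hfu.
  (* The residual of [x1] is [(1 + t) y x0], because [f] vanishes on [y x0]. *)
  assert (Hx1low : (1 + t) * `|y x0| <= `|x1|).
  { pose proof (Hfu x1) as H. unfold x1 in H at 1 2. rewrite Fadd, Fscal, Hfy in H.
    rewrite (norm_eq_scal _ (1 + t) (y x0)) in H by (unfold y; vring).
    rewrite Rabs_pos_eq in H by lra. exact H. }
  assert (Hx1up : `|x1| <= 1 + t).
  { pose proof (norm_triangle _ x0 (t * y x0)%V) as H. fold x1 in H.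
    rewrite norm_scal, Rabs_pos_eq in H by lra. nra. }
  assert (Hp : (1 + t) * (1 - kap) <= `|x1|) by nra.
  assert (Hp0 : 0 < `|x1|) by (unfold kap in Hp; nra).
  destruct (hahn_banach x1) as (g & Hg & Hgn & Hgx).
  set (x2 := ((/ `|x1|) * x1)%V).
  assert (Hx2 : `|x2| = 1) by now apply norm_normalize.
  assert (Hgx2 : g x2 = 1).
  { unfold x2. rewrite (proj1 (proj2 Hg)), Hgx. field; lra. }
  assert (HJ : J X x2 g).
  { split; auto. split; auto. split.
    - intros z Hz. eapply Rle_trans; [apply Hgn|exact Hz].
    - intros eps Heps. exists x2. split; [unfold ball_X; lra|].
      rewrite Hgx2, Rabs_pos_eq; lra. }
  assert (Hhy : - 1 <= h (y x0)).
  { pose proof (Hh1 (opp (y x0))) as H. rewrite norm_opp in H.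
    replace (opp (y x0)) with ((-1) * y x0)%V in H by vring.
    rewrite Hscal in H. lra. }
  assert (Hhx2 : 1 - d0 <= h x2).
  { unfold x2. rewrite Hscal. apply (Rmult_le_reg_l `|x1|); auto.
    rewrite <- Rmult_assoc, Rinv_r, Rmult_1_l by lra.
    unfold x1 at 2. rewrite Hadd, Hscal.
    assert (1 - kap - t <= h x0 + t * h (y x0)) by nra.
    unfold kap in *. nra. }
  pose proof (HJhalf x2 g Hx2 Hhx2 HJ) as Hgu.
  assert (Hfx0 : 1 / 2 <= f x0) by (apply Hfhalf; auto; unfold kap in *; lra).
  pose proof Hg as (Gadd & Gscal & _).
  assert (Hgx0 : g x0 <= 1)
    by (eapply Rle_trans; [apply Rle_abs|]; eapply Rle_trans; [apply Hgn|]; auto).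
  assert (E1 : `|x1| = g x0 + t * g (y x0)).
  { rewrite <- Hgx. unfold x1 at 1. now rewrite Gadd, Gscal. }
  assert (E2 : g (y x0) = g x0 - f x0 * g u).
  { unfold y. rewrite functional_sub, Gscal by auto. ring. }
  assert (G1 : t - kap * (1 + t) <= t * g (y x0)) by lra.
  (* [kap = t / 8] and [t <= 1] give this. On the other side [f x0 >= 1/2] and [g u > 1/2] push
     [g (y x0) = g x0 - f x0 g u] below 3/4. *)
  assert (G2 : 3 / 4 <= g (y x0)).
  { apply (Rmult_le_reg_l t); [lra|]. unfold kap in *. nra. }
  assert (1 / 4 < f x0 * g u) by nra.
  lra.
Qed.

Lemma uniformly_convex_of_slices : uniformly_convex X.
Proof.
  destruct (asymptotic_sup_exists pair_gap 0 2) as (c & Hc0 & Hc).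
  { intros d Hd. exists 0. split; [|lra]. exists u, u. repeat split; try lra.
    - rewrite (norm_eq_scal _ 2 u) by vring. rewrite Hu, Rabs_pos_eq; lra.
    - replace (u - u)%V with (zero : X) by vring. now rewrite norm_zero. }
  { intros d r Hd (a & b & Ha & Hb & _ & ->).
    pose proof (norm_le_add (a - b) a (opp b) eq_refl) as H. rewrite norm_opp in H. lra. }
  destruct (asymptotic_sup_exists slice_width 0 1) as (r & Hr0 & Hr).
  { intros d Hd. destruct (Hslice d Hd) as (x & Hx & Hhx).
    exists `|y x|. split; [exists x; auto|apply norm_nonneg]. }
  { intros d r Hd (x & Hx & _ & ->). specialize (Hfu x). fold (y x) in Hfu. lra. }
  assert (c = 0) as ->.
  { apply Rle_antisym; auto. apply Rnot_lt_le. intros Hpos.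
    pose proof (width_ge_one c r Hc Hr Hpos). pose proof (width_lt_one r Hr). lra. }
  intros eta He. destruct (proj2 Hc eta He) as (d & Hd & H). exists d. split; auto.
  intros a b Ha Hb Hab. rewrite <- (Rplus_0_l eta). apply H. exists a, b. auto.
Qed.

End UniformConvexity.

(** * Weak neighbourhoods and slices at weakly exposed points *)

Section WeakTopology.
Context {X : Banach}.
Implicit Types x y z w : X.

Lemma weak_open_norm_open (U : X -> Prop) x :
  weak_open X U -> U x -> exists eps, 0 < eps /\ forall y, `|y - x| < eps -> U y.
Proof.
  intros HU Hx. destruct (HU x Hx) as (fs & e & Hfs & He & HUy).
  assert (H : exists eps, 0 < eps /\ forall y, `|y - x| < eps ->
            forall g, In g fs -> Rabs (g y - g x) < e).
  { clear HUy. induction Hfs as [|g l Hg _ (eps & Heps & IH)].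
    - exists 1. split; [lra|]. intros y _ g [].
    - destruct (functional_bound g Hg) as (C & HC & Hb).
      exists (Rmin eps (e / C)). split.
      { apply Rmin_glb_lt; auto. now apply Rdiv_lt_0_compat. }
      intros y Hy k [<-|Hk].
      + rewrite <- functional_sub by auto. eapply Rle_lt_trans; [apply Hb|].
        apply Rlt_le_trans with (C * (e / C)); [|right; field; lra].
        apply Rmult_lt_compat_l; auto. eapply Rlt_le_trans; [exact Hy|apply Rmin_r].
      + apply IH; auto. eapply Rlt_le_trans; [exact Hy|apply Rmin_l]. }
  destruct H as (eps & Heps & H). exists eps. split; auto.
Qed.

Lemma weak_conv_eventually (U : X -> Prop) (s : nat -> X) x :
  weak_open X U -> U x -> weak_conv X s x -> exists n, U (s n).
Proof.
  intros HU Hx Hs. destruct (HU x Hx) as (fs & e & Hfs & He & HUy).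
  assert (H : exists N, forall n, (N <= n)%nat ->
            forall g, In g fs -> Rabs (g (s n) - g x) < e).
  { clear HUy. induction Hfs as [|g l Hg _ (N & IH)].
    - exists 0%nat. intros n _ g [].
    - destruct (Hs g Hg e He) as (N' & HN').
      exists (Nat.max N N'). intros n Hn k [<-|Hk].
      + apply HN'. lia.
      + apply IH; auto; lia. }
  destruct H as (N & H). exists N. apply HUy. auto.
Qed.

(** Otherwise each slice of depth [1 / (n + 1)] contains a point outside [U]; these points converge
    weakly to [w], because [h] exposes [w], and so they enter [U]. *)
Lemma weakly_exposed_slice w (h : X -> R) (U : X -> Prop) :
  weakly_exposed_by X w h -> weak_open X U -> U w ->
  exists d, 0 < d /\ forall x, `|x| <= 1 -> 1 - d <= h x -> U x.
Proof.
  intros (_ & (_ & Hh1 & _) & Hexp) HU Hw. apply NNPP. intros Hn.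
  assert (Hseq : forall n, exists x, `|x| <= 1 /\ 1 - / (INR n + 1) <= h x /\ ~ U x).
  { intros n. apply NNPP. intros Hn'. apply Hn. exists (/ (INR n + 1)). split.
    - apply Rinv_0_lt_compat. pose proof (pos_INR n). lra.
    - intros x Hx Hhx. apply NNPP. intros HUx. apply Hn'. eauto. }
  pose (s := fun n => proj1_sig (constructive_indefinite_description _ (Hseq n))).
  assert (Hs : forall n, `|s n| <= 1 /\ 1 - / (INR n + 1) <= h (s n) /\ ~ U (s n))
    by (intros n; unfold s; now destruct (constructive_indefinite_description _ (Hseq n))).
  destruct (weak_conv_eventually U s w HU Hw) as [n HUn].
  - apply Hexp.
    + intros n. apply Hs.
    + intros e He. destruct (archimed_cor1 e He) as (N & HN & HNpos).
      exists N. intros n Hn'. unfold Rdist.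
      destruct (Hs n) as (Hb & Hlow & _).
      pose proof (Hh1 (s n) Hb) as Habs. pose proof (Rle_abs (h (s n))).
      rewrite Rabs_left1 by lra.
      assert (/ (INR n + 1) < / INR N); [|lra].
      apply Rinv_lt_contravar.
      * apply Rmult_lt_0_compat; [apply lt_0_INR; lia|]. pose proof (pos_INR n). lra.
      * assert (INR N <= INR n) by (apply le_INR; lia). lra.
  - now apply (Hs n).
Qed.

Lemma functional_strip_weak_open (g : X -> R) x e :
  is_functional X g -> weak_open X (fun y => Rabs (g y - g x) < e).
Proof.
  intros Hg y Hy. exists (g :: nil), (e - Rabs (g y - g x)).
  split; [auto|split]; [lra|].
  intros z Hz. specialize (Hz g (or_introl eq_refl)).
  replace (g z - g x) with ((g z - g y) + (g y - g x)) by ring.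
  eapply Rle_lt_trans; [apply Rabs_triang|]. lra.
Qed.

Lemma dual_sphere_slice (h : X -> R) d :
  dual_sphere X h -> 0 < d -> exists x, `|x| <= 1 /\ 1 - d <= h x.
Proof.
  intros ((_ & Hs & _) & _ & Hn) Hd. destruct (Hn d Hd) as (x & Hx & Hhx).
  destruct (Rcase_abs (h x)) as [hx|hx].
  - exists ((-1) * x)%V. rewrite norm_scal, Hs. split.
    + unfold ball_X in Hx. rewrite Rabs_left; lra.
    + rewrite Rabs_left in Hhx; lra.
  - exists x. split; auto. rewrite Rabs_pos_eq in Hhx; lra.
Qed.

Lemma projection_functional u (P : X -> X) :
  `|u| = 1 -> is_linear X P -> (forall x, P (P x) = P x) ->
  (forall y, (exists x, P x = y) <-> (exists a, y = scal a u)) ->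
  (forall x, `|P x| <= `|x|) ->
  exists f, is_functional X f /\ (forall x, P x = (f x * u)%V) /\
    f u = 1 /\ forall x, Rabs (f x) <= `|x|.
Proof.
  intros Hu [Padd Pscal] PP Hran Pnorm.
  assert (Hex : forall x, exists a, P x = (a * u)%V) by (intros x; apply Hran; eauto).
  pose (f := fun x => proj1_sig (constructive_indefinite_description _ (Hex x))).
  assert (Hf : forall x, P x = (f x * u)%V)
    by (intros x; unfold f; now destruct (constructive_indefinite_description _ (Hex x))).
  assert (Hinj : forall a b : R, (a * u)%V = (b * u)%V -> a = b).
  { intros a b H. assert (E : `|(a - b) * u| = 0).
    { replace ((a - b) * u)%V with (a * u - b * u)%V by vring. rewrite H.
      replace (b * u - b * u)%V with (zero : X) by vring. apply norm_zero. }
    rewrite norm_scal, Hu, Rmult_1_r in E.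
    destruct (Req_dec (a - b) 0) as [h|h]; [lra|].
    exfalso. now apply (Rabs_no_R0 _ h). }
  assert (Hb : forall x, Rabs (f x) <= `|x|).
  { intros x. specialize (Pnorm x). rewrite Hf, norm_scal, Hu in Pnorm. lra. }
  exists f. split; [|split; [|split]]; auto.
  - split; [|split].
    + intros x y. apply Hinj. rewrite <- Hf, Padd, !Hf. vring.
    + intros a x. apply Hinj. rewrite <- Hf, Pscal, Hf. vring.
    + exists 1. intros x. rewrite Rmult_1_l. auto.
  - apply Hinj. rewrite <- Hf.
    destruct (proj2 (Hran u)) as [x Hx]; [exists 1; vring|].
    rewrite <- Hx, PP. vring.
Qed.

Lemma uniformly_convex_of_weakly_exposed u (f : X -> R) :
  convex_transitive X -> `|u| = 1 ->
  is_functional X f -> f u = 1 -> (forall x, `|x - f x * u| <= `|x|) ->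
  (forall y, sphere_X X y -> forall eps, 0 < eps ->
     exists x, weakly_exposed X x /\ `|x - y| < eps) ->
  usc_weak_at X (uJ X u) u ->
  uniformly_convex X.
Proof.
  intros Hct Hu Hf Hfu1 Hfu Hdense Husc.
  (* Support functionals of [u] take the value 1 at [u], so this open half-line contains all values
     of [uJ] there. *)
  destruct (Husc (fun r => 1 / 2 < r)) as (U & HU & HUu & HUs).
  { intros v Hv. exists (v - 1 / 2). split; [lra|]. intros w Hw.
    apply Rabs_def2 in Hw. lra. }
  { intros r (g & (_ & Hg) & ->). lra. }
  destruct (weak_open_norm_open U u HU HUu) as (e1 & He1 & HU1).
  destruct (weak_open_norm_open _ u (functional_strip_weak_open f u (1 / 4) Hf))
    as (e2 & He2 & Hf2).
  { replace (f u - f u) with 0 by ring. rewrite Rabs_R0. lra. }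
  (* [w] is so near [u] that it lies in [U] and [f w > 3/4]; small slices at [w] then stay in [U]
     and keep [f] above 1/2. *)
  destruct (Hdense u Hu (Rmin e1 e2)) as (w & (h & Hwh) & Hwu).
  { now apply Rmin_glb_lt. }
  assert (HUw : U w) by (apply HU1; eapply Rlt_le_trans; [exact Hwu|apply Rmin_l]).
  assert (Hfw : Rabs (f w - f u) < 1 / 4)
    by (apply Hf2; eapply Rlt_le_trans; [exact Hwu|apply Rmin_r]).
  assert (Hosc : forall eta, 0 < eta -> exists d, 0 < d /\
            forall x, `|x| <= 1 -> 1 - d <= h x -> Rabs (f x - f w) < eta).
  { intros eta He.
    apply (weakly_exposed_slice w h (fun x => Rabs (f x - f w) < eta)); auto.
    - now apply functional_strip_weak_open.
    - replace (f w - f w) with 0 by ring. now rewrite Rabs_R0. }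
  destruct (weakly_exposed_slice w h U Hwh HU HUw) as (d1 & Hd1 & Hs1).
  destruct (Hosc (1 / 4)) as (d2 & Hd2 & Hs2); [lra|].
  destruct Hwh as (_ & Hh & _).
  pose proof (Rmin_l d1 d2). pose proof (Rmin_r d1 d2).
  apply (uniformly_convex_of_slices u f h) with (d0 := Rmin d1 d2); auto.
  - apply Hh.
  - intros x Hx. eapply Rle_trans; [apply Rle_abs|]. now apply Hh.
  - intros d Hd. now apply dual_sphere_slice.
  - intros eta He. destruct (Hosc (eta / 2)) as (d & Hd & Ho); [lra|].
    exists d. split; auto. intros a b Ha Hb Hha Hhb.
    specialize (Ho a Ha Hha) as Oa. specialize (Ho b Hb Hhb) as Ob.
    apply Rabs_def2 in Oa, Ob. apply Rabs_le. lra.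
  - now apply Rmin_glb_lt.
  - intros x Hx Hhx. specialize (Hs2 x Hx ltac:(lra)).
    apply Rabs_def2 in Hs2, Hfw. lra.
  - intros x g Hx Hhx Hg. apply (HUs x); auto.
    + apply Hs1; lra.
    + now exists g.
Qed.

End WeakTopology.

(** * The duality form *)

Section DualityForm.
Context {X : Banach}.
Implicit Types x y v w a b : X.

Lemma uniformly_convex_rescaled eta M :
  uniformly_convex X -> 0 < eta -> 0 <= M ->
  exists d, 0 < d /\ forall a b, `|a| <= M -> `|b| <= `|a| + d ->
    2 * `|a| - d <= `|a + b| -> `|a - b| < eta.
Proof.
  intros Huc He HM.
  assert (Hq : 0 < eta / (M + 1)) by (apply Rdiv_lt_0_compat; lra).
  destruct (Huc _ Hq) as (d1 & Hd1 & H1).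
  exists (Rmin 1 (Rmin (eta / 8) (d1 * eta / 24))).
  set (d := Rmin 1 (Rmin (eta / 8) (d1 * eta / 24))).
  assert (Hd : 0 < d /\ d <= 1 /\ d <= eta / 8 /\ d <= d1 * eta / 24).
  { unfold d. pose proof (Rmin_l 1 (Rmin (eta / 8) (d1 * eta / 24))).
    pose proof (Rmin_r 1 (Rmin (eta / 8) (d1 * eta / 24))).
    pose proof (Rmin_l (eta / 8) (d1 * eta / 24)).
    pose proof (Rmin_r (eta / 8) (d1 * eta / 24)).
    assert (0 < Rmin 1 (Rmin (eta / 8) (d1 * eta / 24)))
      by (repeat apply Rmin_glb_lt; nra). lra. }
  clearbody d. split; [lra|]. intros a b Ha Hb Hab.
  set (D := `|a| + d) in *. pose proof (norm_nonneg _ a) as Hna.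
  assert (HD : 0 < D) by (unfold D; lra).
  assert (Hi : 0 < / D) by now apply Rinv_0_lt_compat.
  (* For small [D] the triangle inequality suffices. Otherwise both vectors are divided by [D], and
     the defect [3 d / D] of the sum stays below [d1]. *)
  destruct (Rle_lt_dec D (eta / 4)) as [hD|hD].
  - pose proof (norm_le_add (a - b) a (opp b) eq_refl) as H. rewrite norm_opp in H.
    unfold D in *. lra.
  - assert (Hscale : forall z : X, `|z| <= D -> `|/ D * z| <= 1).
    { intros z Hz. rewrite norm_scal, Rabs_pos_eq by lra.
      apply (Rmult_le_reg_l D); auto. rewrite <- Rmult_assoc, Rinv_r by lra. lra. }
    assert (H : `|/ D * a - / D * b| < eta / (M + 1)).
    { apply H1; [apply Hscale; unfold D; lra|now apply Hscale|].
      rewrite (norm_eq_scal _ (/ D) (a + b)) by vring.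
      rewrite Rabs_pos_eq by lra.
      apply (Rmult_le_reg_l D); auto. rewrite <- Rmult_assoc, Rinv_r by lra.
      unfold D in *. nra. }
    rewrite (norm_eq_scal _ (/ D) (a - b)) in H by vring.
    rewrite Rabs_pos_eq in H by lra.
    apply (Rmult_lt_compat_l D) in H; auto.
    rewrite <- Rmult_assoc, Rinv_r, Rmult_1_l in H by lra.
    apply Rlt_le_trans with (1 := H).
    apply Rle_trans with ((M + 1) * (eta / (M + 1))); [|right; field; lra].
    apply Rmult_le_compat_r; unfold D; lra.
Qed.

(** The residuals of two best approximations have equal length and their midpoint is no shorter, so
    uniform convexity brings them together. *)
Lemma best_approximation_unique x y (s s' : R) :
  uniformly_convex X -> x <> zero ->
  (forall t, `|y - s * x| <= `|y - t * x|) ->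
  (forall t, `|y - s' * x| <= `|y - t * x|) -> s = s'.
Proof.
  intros Huc Hx Hs Hs'. apply norm_pos in Hx.
  destruct (Req_dec s s') as [h|h]; auto. exfalso.
  assert (Hpos : 0 < Rabs (s - s') * `|x|).
  { apply Rmult_lt_0_compat; auto. apply Rabs_pos_lt. lra. }
  destruct (uniformly_convex_rescaled _ `|y - s * x| Huc Hpos (norm_nonneg _ _))
    as (d & Hd & H).
  specialize (H (y - s * x)%V (y - s' * x)%V (Rle_refl _)).
  rewrite (norm_eq_scal ((y - s * x) - (y - s' * x)) (s' - s) x), (Rabs_minus_sym s' s) in H by vring.
  assert (`|y - s' * x| <= `|y - s * x| + d) by (specialize (Hs' s); lra).
  assert (2 * `|y - s * x| - d <= `|(y - s * x) + (y - s' * x)|).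
  { rewrite (norm_eq_scal ((y - s * x) + (y - s' * x)) 2 (y - ((s + s') / 2) * x)) by (vreduce; field).
    rewrite Rabs_pos_eq by lra. specialize (Hs ((s + s') / 2)). lra. }
  specialize (H H0 H1). lra.
Qed.

(** An isometry makes [f (T x)] almost [f u = 1]; then [T x + u] has norm almost 2, and uniform
    convexity applies. *)
Lemma convex_transitive_dense_orbit u (f : X -> R) x eps :
  convex_transitive X -> uniformly_convex X ->
  is_functional X f -> (forall y, Rabs (f y) <= `|y|) -> f u = 1 -> `|u| = 1 ->
  `|x| = 1 -> 0 < eps ->
  exists T, is_surj_lin_isometry X T /\ `|T x - u| < eps.
Proof.
  intros Hct Huc Hf Hf1 Hfu Hu Hx He.
  destruct (Huc eps He) as (d & Hd & H).
  destruct (convex_transitive_functional f x u d) as (T & HT & HTx); auto.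
  { unfold ball_X; lra. }
  exists T. split; auto. pose proof HT as (_ & Tnorm & _).
  apply H; [rewrite Tnorm; lra|lra|].
  specialize (Hf1 (T x + u)%V). rewrite (proj1 Hf) in Hf1.
  pose proof (Rle_abs (f (T x) + f u)). lra.
Qed.

Lemma Un_cv_le_compat (s s' : nat -> R) (l l' : R) :
  (forall n, s n <= s' n) -> Un_cv s l -> Un_cv s' l' -> l <= l'.
Proof.
  intros Hle Hs Hs'. apply le_epsilon. intros e He.
  destruct (Hs (e / 2)) as (N & HN); [lra|].
  destruct (Hs' (e / 2)) as (N' & HN'); [lra|].
  specialize (HN (Nat.max N N') ltac:(lia)). specialize (HN' (Nat.max N N') ltac:(lia)).
  specialize (Hle (Nat.max N N')). unfold Rdist in *.
  apply Rabs_def2 in HN, HN'. lra.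
Qed.

(* [phi] is the coordinate functional of a bicontractive projection onto the line of [x]. *)
Definition bicontractive_at x (phi : X -> R) : Prop :=
  is_functional X phi /\ phi x = 1 /\ (forall y, Rabs (phi y) <= `|y|) /\
  (forall y, `|y - phi y * x| <= `|y|).

(** The vectors [y] and [y - t x] have the same residual, so contractivity is applied to the
    latter. *)
Lemma bicontractive_best x phi y t :
  bicontractive_at x phi -> `|y - phi y * x| <= `|y - t * x|.
Proof.
  intros (Hphi & Hx & _ & H). specialize (H (y - t * x)%V).
  rewrite (functional_sub phi), (proj1 (proj2 Hphi)), Hx in H by auto.
  replace ((y - t * x) - (phi y - t * 1) * x)%V with (y - phi y * x)%V in H by vring.
  exact H.
Qed.

Lemma inv_succ_cv : Un_cv (fun n => / (INR n + 1)) 0.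
Proof.
  intros e He. destruct (archimed_cor1 e He) as (N & HN & HNpos).
  exists N. intros n Hn. unfold Rdist.
  assert (0 < / (INR n + 1)) by (apply Rinv_0_lt_compat; pose proof (pos_INR n); lra).
  rewrite Rminus_0_r, Rabs_pos_eq by lra.
  apply Rlt_trans with (/ INR N); auto.
  apply Rinv_lt_contravar.
  - apply Rmult_lt_0_compat; [apply lt_0_INR; lia|]. pose proof (pos_INR n). lra.
  - assert (INR N <= INR n) by (apply le_INR; lia). lra.
Qed.

(* The functionals [f o T], with [T x] close to [u], give almost best approximations, so
   uniform convexity makes them converge pointwise. *)
Lemma bicontractive_everywhere u f x :
  uniformly_convex X -> bicontractive_at u f -> `|u| = 1 -> `|x| = 1 ->
  (forall eps, 0 < eps -> exists T, is_surj_lin_isometry X T /\ `|T x - u| < eps) ->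
  exists phi, bicontractive_at x phi.
Proof.
  intros Huc Hbi Hu Hx Horb.
  assert (Hseq : forall n : nat, exists T, is_surj_lin_isometry X T /\
            `|T x - u| < / (INR n + 1)).
  { intros n. apply Horb. apply Rinv_0_lt_compat. pose proof (pos_INR n). lra. }
  pose (T := fun n => proj1_sig (constructive_indefinite_description _ (Hseq n))).
  assert (HT : forall n, is_surj_lin_isometry X (T n) /\ `|T n x - u| < / (INR n + 1))
    by (intros n; unfold T; now destruct (constructive_indefinite_description _ (Hseq n))).
  (* After applying [T n] this compares approximations by multiples of [T n x]; exchanging [T n x]
     for [u], where [f] is optimal, costs the coefficients times the distance. *)
  assert (Hnear : forall n y t, `|y - f (T n y) * x| <=
            `|y - t * x| + (Rabs t + `|y|) * / (INR n + 1)).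
  { intros n y t. destruct (HT n) as [HTn Hd]. pose proof HTn as ((Tadd & Tscal) & Tnorm & _).
    pose proof (bicontractive_best u f (T n y) t Hbi) as Hbest.
    destruct Hbi as (_ & _ & Hf1 & _). specialize (Hf1 (T n y)). rewrite Tnorm in Hf1.
    rewrite <- (Tnorm (y - f (T n y) * x)%V), <- (Tnorm (y - t * x)%V).
    rewrite !isometry_sub, !Tscal by auto.
    pose proof (norm_le_add (T n y - f (T n y) * T n x) (T n y - f (T n y) * u)
      ((- f (T n y)) * (T n x - u)) ltac:(vring)) as H1.
    pose proof (norm_le_add (T n y - t * u) (T n y - t * T n x)
      (t * (T n x - u)) ltac:(vring)) as H2.
    rewrite norm_scal, Rabs_Ropp in H1. rewrite norm_scal in H2.
    pose proof (norm_nonneg _ (T n x - u)%V). pose proof (Rabs_pos t).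
    pose proof (Rabs_pos (f (T n y))). pose proof (norm_nonneg _ y).
    assert (Rabs (f (T n y)) * `|T n x - u| <= `|y| * / (INR n + 1))
      by (apply Rmult_le_compat; lra).
    assert (Rabs t * `|T n x - u| <= Rabs t * / (INR n + 1))
      by (apply Rmult_le_compat_l; lra).
    lra. }
  assert (Hfb : forall n y, Rabs (f (T n y)) <= `|y|).
  { intros n y. destruct Hbi as (_ & _ & Hf1 & _).
    destruct (HT n) as ((_ & Tnorm & _) & _). rewrite <- (Tnorm y). apply Hf1. }
  assert (Hcauchy : forall y, Cauchy_crit (fun n => f (T n y))).
  { intros y e He.
    destruct (uniformly_convex_rescaled e (2 * `|y|) Huc He) as (d & Hd & H).
    { pose proof (norm_nonneg _ y). lra. }
    assert (Hd' : 0 < d / (4 * `|y| + 1)).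
    { apply Rdiv_lt_0_compat; auto. pose proof (norm_nonneg _ y). lra. }
    destruct (inv_succ_cv _ Hd') as (N & HN). exists N.
    assert (Hsmall : forall n, (n >= N)%nat -> 4 * `|y| * / (INR n + 1) <= d).
    { intros n Hn. specialize (HN n Hn). unfold Rdist in HN.
      rewrite Rminus_0_r in HN. pose proof (Rle_abs (/ (INR n + 1))).
      pose proof (norm_nonneg _ y).
      apply Rle_trans with ((4 * `|y| + 1) * (d / (4 * `|y| + 1))); [|right; field; lra].
      apply Rmult_le_compat; try lra.
      left. apply Rinv_0_lt_compat. pose proof (pos_INR n). lra. }
    intros n m Hn Hm. unfold Rdist.
    (* [Hnear] is used twice: against the other coefficient, to compare the two lengths, and against
       the mean coefficient, to bound the sum below. *)
    assert (Hd1 : `|(y - f (T n y) * x) - (y - f (T m y) * x)| < e).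
    { pose proof (Hfb n y). pose proof (Hfb m y).
      assert (Hin : 0 < / (INR n + 1))
        by (apply Rinv_0_lt_compat; pose proof (pos_INR n); lra).
      assert (Him : 0 < / (INR m + 1))
        by (apply Rinv_0_lt_compat; pose proof (pos_INR m); lra).
      pose proof (Hsmall n Hn). pose proof (Hsmall m Hm). pose proof (norm_nonneg _ y).
      apply H.
      - pose proof (norm_le_add (y - f (T n y) * x) y ((- f (T n y)) * x) ltac:(vring)) as H5.
        rewrite norm_scal, Rabs_Ropp, Hx in H5. lra.
      - pose proof (Hnear m y (f (T n y))). nra.
      - rewrite (norm_eq_scal ((y - f (T n y) * x) + (y - f (T m y) * x)) 2
          (y - ((f (T n y) + f (T m y)) / 2) * x)) by (vreduce; field).
        rewrite Rabs_pos_eq by lra.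
        pose proof (Hnear n y ((f (T n y) + f (T m y)) / 2)) as H5.
        assert (Rabs ((f (T n y) + f (T m y)) / 2) <= `|y|).
        { apply Rabs_le.
          assert (A : forall r s, Rabs r <= s -> - s <= r <= s)
            by (intros r s Hrs; pose proof (Rle_abs r); pose proof (Rle_abs (- r));
                rewrite Rabs_Ropp in *; lra).
          pose proof (A _ _ (Hfb n y)). pose proof (A _ _ (Hfb m y)). lra. }
        nra. }
    rewrite (norm_eq_scal _ (f (T m y) - f (T n y)) x) in Hd1 by vring.
    rewrite Hx, Rmult_1_r, Rabs_minus_sym in Hd1. exact Hd1. }
  pose (phi := fun y => proj1_sig (R_complete _ (Hcauchy y))).
  assert (Hphi : forall y, Un_cv (fun n => f (T n y)) (phi y))
    by (intros y; unfold phi; now destruct (R_complete _ (Hcauchy y))).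
  pose proof Hbi as ((Fadd & Fscal & _) & _).
  assert (Hb : forall y, Rabs (phi y) <= `|y|).
  { intros y. apply (Un_cv_le_compat (fun n => Rabs (f (T n y))) (fun _ => `|y|)).
    - intros n. apply Hfb.
    - apply cv_cvabs, Hphi.
    - intros e He. exists 0%nat. intros. unfold Rdist.
      replace (`|y| - `|y|) with 0 by ring. now rewrite Rabs_R0. }
  assert (Hbest : forall y t, `|y - phi y * x| <= `|y - t * x|).
  { intros y t. apply le_epsilon. intros e He.
    pose proof (norm_nonneg _ y) as Hy. pose proof (Rabs_pos t) as Ht.
    assert (He2 : 0 < e / 2 / (Rabs t + `|y| + 1)) by (apply Rdiv_lt_0_compat; lra).
    destruct (inv_succ_cv _ He2) as (N1 & HN1).
    destruct (Hphi y (e / 2)) as (N2 & HN2); [lra|].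
    set (n := Nat.max N1 N2).
    specialize (HN1 n ltac:(lia)). specialize (HN2 n ltac:(lia)). unfold Rdist in *.
    rewrite Rminus_0_r in HN1. pose proof (Rle_abs (/ (INR n + 1))) as Hi.
    pose proof (Hnear n y t) as H1.
    assert (Hip : 0 < / (INR n + 1))
      by (apply Rinv_0_lt_compat; pose proof (pos_INR n); lra).
    assert (H2 : (Rabs t + `|y|) * / (INR n + 1) <= e / 2).
    { apply Rle_trans with ((Rabs t + `|y| + 1) * (e / 2 / (Rabs t + `|y| + 1)));
        [|right; field; lra].
      apply Rmult_le_compat; lra. }
    pose proof (norm_le_add (y - phi y * x) (y - f (T n y) * x)
      ((f (T n y) - phi y) * x) ltac:(vring)) as H3.
    rewrite norm_scal, Hx in H3. lra. }
  exists phi. split; [|split; [|split]]; auto.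
  - split; [|split].
    + intros y z. apply (UL_sequence (fun n => f (T n (y + z)%V))); [apply Hphi|].
      intros e He. destruct (CV_plus _ _ _ _ (Hphi y) (Hphi z) e He) as (N & HN).
      exists N. intros n Hn. destruct (HT n) as (((Tadd & _) & _) & _).
      rewrite Tadd, Fadd. auto.
    + intros a y. apply (UL_sequence (fun n => f (T n (a * y)%V))); [apply Hphi|].
      assert (Hc : Un_cv (fun _ => a) a).
      { intros e He. exists 0%nat. intros. unfold Rdist.
        replace (a - a) with 0 by ring. now rewrite Rabs_R0. }
      intros e He. destruct (CV_mult _ _ _ _ Hc (Hphi y) e He) as (N & HN).
      exists N. intros n Hn. destruct (HT n) as (((_ & Tscal) & _) & _).
      rewrite Tscal, Fscal. auto.
    + exists 1. intros y. rewrite Rmult_1_l. auto.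
  (* The approximation of [x] by itself is exact, which forces [phi x = 1]. *)
  - specialize (Hbest x 1).
    rewrite (norm_eq_scal (x - 1 * x) 0 x), Rabs_R0 in Hbest by vring.
    rewrite (norm_eq_scal _ (1 - phi x) x), Hx, Rmult_1_r in Hbest by vring.
    destruct (Req_dec (1 - phi x) 0) as [h|h]; [lra|].
    apply Rabs_pos_lt in h. lra.
  - intros y. specialize (Hbest y 0). replace (y - 0 * x)%V with y in Hbest by vring.
    exact Hbest.
Qed.

End DualityForm.

(** * The duality form, its orthogonality and its slopes *)

Section Form.
Context {X : Banach}.
Implicit Types x y z e p q v w : X.

(** A semi-inner product, linear in the second argument only. The last clause turns Birkhoff-James
    orthogonality of [v] to [w] into [B w v = 0], with the arguments exchanged. *)
Definition duality_form (B : X -> X -> R) : Prop :=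
  (forall v w w', B v (w + w')%V = B v w + B v w') /\
  (forall v a w, B v (a * w)%V = a * B v w) /\
  (forall v, B v v = `|v| * `|v|) /\
  (forall v w, Rabs (B v w) <= `|v| * `|w|) /\
  (forall v w, (forall t, `|v| <= `|v - t * w|) -> B w v = 0).

Lemma duality_form_exists :
  uniformly_convex X ->
  (forall x, `|x| = 1 -> exists phi, bicontractive_at x phi) ->
  exists B, duality_form B.
Proof.
  intros Huc Hbi.
  assert (Hex : forall x, exists phi, `|x| = 1 -> bicontractive_at x phi).
  { intros x. destruct (classic (`|x| = 1)) as [h|h].
    - destruct (Hbi x h) as [phi Hphi]. eauto.
    (* A default off the unit sphere, where nothing is claimed. *)
    - exists (fun _ => 0). tauto. }
  pose (Phi := fun x => proj1_sig (constructive_indefinite_description _ (Hex x))).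
  assert (HPhi : forall x, `|x| = 1 -> bicontractive_at x (Phi x))
    by (intros x; unfold Phi; now destruct (constructive_indefinite_description _ (Hex x))).
  assert (Hunit : forall v, v <> zero -> bicontractive_at (/ `|v| * v)%V (Phi (/ `|v| * v)%V)).
  { intros v Hv. apply HPhi, norm_normalize, norm_pos, Hv. }
  exists (fun v w => `|v| * Phi (/ `|v| * v)%V w).
  assert (Hz : forall v, v = zero \/ v <> zero) by (intros v; apply classic).
  split; [|split; [|split; [|split]]].
  - intros v w w'. destruct (Hz v) as [->|Hv]; [rewrite norm_zero; ring|].
    destruct (Hunit v Hv) as ((Ha & _) & _). rewrite Ha. ring.
  - intros v a w. destruct (Hz v) as [->|Hv]; [rewrite norm_zero; ring|].
    destruct (Hunit v Hv) as ((_ & Hs & _) & _). rewrite Hs. ring.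
  - intros v. destruct (Hz v) as [->|Hv]; [rewrite norm_zero; ring|].
    destruct (Hunit v Hv) as ((_ & Hs & _) & H1 & _). apply norm_pos in Hv.
    set (psi := Phi (/ `|v| * v)%V) in *.
    rewrite Hs in H1. f_equal.
    apply (Rmult_eq_reg_l (/ `|v|)); [|apply Rinv_neq_0_compat; lra].
    rewrite H1. field. lra.
  - intros v w. destruct (Hz v) as [->|Hv].
    + rewrite norm_zero, !Rmult_0_l, Rabs_R0. lra.
    + rewrite Rabs_mult, (Rabs_pos_eq `|v|) by apply norm_nonneg.
      apply Rmult_le_compat_l; [apply norm_nonneg|]. now apply (Hunit v Hv).
  - intros v w Hvw. destruct (Hz w) as [->|Hw]; [rewrite norm_zero; ring|].
    pose proof (Hunit w Hw) as Hbw. apply norm_pos in Hw.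
    assert (Hw1 : `|/ `|w| * w| = 1) by now apply norm_normalize.
    replace (Phi (/ `|w| * w)%V v) with 0; [ring|].
    (* By hypothesis 0 is a best coefficient for [v] along [w], and the value of [Phi] is
       another. *)
    apply (best_approximation_unique (/ `|w| * w) v); auto.
    + apply norm_nonzero. lra.
    + intros t. replace (v - 0 * (/ `|w| * w))%V with v by vring.
      specialize (Hvw (t * / `|w|)).
      replace (v - (t * / `|w|) * w)%V with (v - t * (/ `|w| * w))%V in Hvw by vring.
      exact Hvw.
    + intros t. now apply bicontractive_best.
Qed.

Section WithForm.
Variable B : X -> X -> R.
Hypothesis HB : duality_form B.

Let Badd v w w' : B v (w + w')%V = B v w + B v w'.
Proof. apply HB. Qed.
Let Bscal v a w : B v (a * w)%V = a * B v w.
Proof. apply HB. Qed.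
Let Bself v : B v v = `|v| * `|v|.
Proof. apply HB. Qed.
Let Bbound v w : Rabs (B v w) <= `|v| * `|w|.
Proof. apply HB. Qed.

Lemma form_sub v w w' : B v (w - w')%V = B v w - B v w'.
Proof.
  replace (w - w')%V with (w + (-1) * w')%V by vring. rewrite Badd, Bscal. ring.
Qed.

Lemma form_le v w : B v w <= `|v| * `|w|.
Proof. eapply Rle_trans; [apply Rle_abs|apply Bbound]. Qed.

(** [B v] takes the value [|v|^2] at [v - t w], and it has norm at most [|v|]. *)
Lemma form_zero_orthogonal v w t : B v w = 0 -> `|v| <= `|v - t * w|.
Proof.
  intros H0. pose proof (form_le v (v - t * w)) as H.
  rewrite form_sub, Bscal, H0, Bself in H.
  pose proof (norm_nonneg _ v). pose proof (norm_nonneg _ (v - t * w)%V). nra.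
Qed.

Lemma form_zero_sym v w : B v w = 0 -> B w v = 0.
Proof. intros H. apply HB. intros t. now apply form_zero_orthogonal. Qed.

(** The combination [w] of [x] and [e] is annihilated by [B v] and by [B z]. By symmetry of the zero
    set [B w] annihilates [v] and [z], hence [l v + z], and symmetry leads back to [w]. *)
Lemma form_coordinate_ratio v z x e (l : R) :
  B z x = 0 -> B z e = 0 ->
  B (l * v + z) x * B v e = B (l * v + z) e * B v x.
Proof.
  intros Hx He. set (w := ((- B v e) * x + B v x * e)%V).
  assert (H1 : B w v = 0).
  { apply form_zero_sym. unfold w. rewrite Badd, !Bscal. ring. }
  assert (H2 : B w z = 0).
  { apply form_zero_sym. unfold w. rewrite Badd, !Bscal, Hx, He. ring. }
  assert (H3 : B (l * v + z) w = 0).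
  { apply form_zero_sym. rewrite Badd, Bscal, H1, H2. ring. }
  unfold w in H3. rewrite Badd, !Bscal in H3. lra.
Qed.

Definition orthonormal x e : Prop := `|x| = 1 /\ `|e| = 1 /\ B x e = 0.

Lemma orthonormal_sym x e : orthonormal x e -> orthonormal e x.
Proof. intros (Hx & He & H). split; [|split]; auto. now apply form_zero_sym. Qed.

Lemma orthonormal_opp x e : orthonormal x e -> orthonormal x (opp e).
Proof.
  intros (Hx & He & H). split; [|split]; auto.
  - now rewrite norm_opp.
  - replace (opp e) with ((-1) * e)%V by vring. rewrite Bscal, H. ring.
Qed.

Lemma orthonormal_coord_l x e a b : orthonormal x e -> B x (a * x + b * e) = a.
Proof.
  intros (Hx & He & H). rewrite Badd, !Bscal, H, Bself, Hx. ring.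
Qed.

Lemma orthonormal_coord_r x e a b : orthonormal x e -> B e (a * x + b * e) = b.
Proof.
  intros H. rewrite add_comm. now apply orthonormal_coord_l, orthonormal_sym.
Qed.

(* The direction of [B (x + a e)] in the plane of [x] and [e]; it is [a] in a Hilbert space. *)
Definition slope x e (a : R) : R := B (x + a * e) e / B (x + a * e) x.

Lemma slope_denominator x e a : orthonormal x e -> B (x + a * e) x <> 0.
Proof.
  intros H H0. apply form_zero_sym in H0.
  replace (x + a * e)%V with (1 * x + a * e)%V in H0 by vring.
  rewrite orthonormal_coord_l in H0 by auto. lra.
Qed.

Lemma slope_nonzero x e a : orthonormal x e -> a <> 0 -> slope x e a <> 0.
Proof.
  intros H Ha. unfold slope, Rdiv. apply Rmult_integral_contrapositive_currified.
  - intros H0. apply form_zero_sym in H0.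
    replace (x + a * e)%V with (1 * x + a * e)%V in H0 by vring.
    rewrite orthonormal_coord_r in H0; auto.
  - apply Rinv_neq_0_compat. now apply slope_denominator.
Qed.

(** The three slopes are the ratios between the values of [B v] at [x], [y] and [e] for one vector
    [v = x + b y + c e]: dropping a component orthogonal to the other two axes keeps the ratio. *)
Lemma slope_compose x y e b c :
  orthonormal x y -> orthonormal x e -> orthonormal y e -> b <> 0 ->
  slope x e c = slope y e (c / b) * slope x y b.
Proof.
  intros Hxy Hxe Hye Hb.
  set (v := (x + b * y + c * e)%V).
  pose proof (orthonormal_sym _ _ Hxy) as Hyx. pose proof (orthonormal_sym _ _ Hxe) as Hex.
  pose proof (orthonormal_sym _ _ Hye) as Hey.
  assert (Z : forall p q t, orthonormal p q -> B (t * p) q = 0).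
  { intros p q t Hpq. apply form_zero_sym. rewrite Bscal.
    destruct (orthonormal_sym _ _ Hpq) as (_ & _ & ->). ring. }
  pose proof (form_coordinate_ratio (x + c * e) (b * y) x e 1 (Z _ _ _ Hyx) (Z _ _ _ Hye)) as R1.
  pose proof (form_coordinate_ratio (x + b * y) (c * e) x y 1 (Z _ _ _ Hex) (Z _ _ _ Hey)) as R2.
  assert (Hx1 : B x y = 0) by apply Hxy. assert (Hx2 : B x e = 0) by apply Hxe.
  pose proof (form_coordinate_ratio (y + (c / b) * e) x y e b Hx1 Hx2) as R3.
  replace (1 * (x + c * e) + b * y)%V with v in R1 by (unfold v; vring).
  replace (1 * (x + b * y) + c * e)%V with v in R2 by (unfold v; vring).
  replace (b * (y + (c / b) * e) + x)%V with v in R3 by (unfold v; vreduce; field; auto).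
  pose proof (slope_denominator x e c Hxe) as D1.
  pose proof (slope_denominator x y b Hxy) as D2.
  pose proof (slope_denominator y e (c / b) Hye) as D3.
  assert (Vx : B v x <> 0).
  { intros H0. apply form_zero_sym in H0. unfold v in H0.
    rewrite !Badd, !Bscal, Hx1, Hx2, Bself in H0. destruct Hxy as (Hx & _).
    rewrite Hx in H0. lra. }
  assert (Vy : B v y <> 0).
  { intros H0. apply form_zero_sym in H0. unfold v in H0.
    destruct Hyx as (Hy & _ & Hyx0). destruct Hye as (_ & _ & Hye0).
    rewrite !Badd, !Bscal, Hyx0, Hye0, Bself, Hy in H0. lra. }
  unfold slope.
  replace (B (x + c * e) e / B (x + c * e) x) with (B v e / B v x)
    by (field_simplify_eq; [lra|auto]).
  replace (B (y + (c / b) * e) e / B (y + (c / b) * e) y) with (B v e / B v y)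
    by (field_simplify_eq; [lra|auto]).
  replace (B (x + b * y) y / B (x + b * y) x) with (B v y / B v x)
    by (field_simplify_eq; [lra|auto]).
  field; auto.
Qed.

(** With [b = - 1 / slope x e a] the form [B (x + a e)] annihilates [x + b e]; exchanging the two
    vectors yields the slope at [b]. *)
Lemma slope_involution x e a :
  orthonormal x e -> a <> 0 -> slope x e (- 1 / slope x e a) = - 1 / a.
Proof.
  intros H Ha. pose proof (slope_nonzero x e a H Ha) as Hs.
  set (b := - 1 / slope x e a).
  pose proof (slope_denominator x e a H) as D1.
  pose proof (slope_denominator x e b H) as D2.
  assert (E1 : B (x + a * e) (x + b * e) = 0).
  { rewrite Badd, Bscal. unfold b. unfold slope in *. field.
    split; auto. intros H0. apply Hs. unfold Rdiv. rewrite H0. ring. }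
  apply form_zero_sym in E1. rewrite Badd, Bscal in E1.
  unfold slope. field_simplify_eq; [lra|auto].
Qed.

(** [|v|^2] is the sum of [B v x] and [a B v e]. Each form value is at most [|v|], while [|v|] is at
    least 1 and at least [a], which bounds both summands below. *)
Lemma slope_bounds x e a :
  orthonormal x e -> 0 < a ->
  0 < B (x + a * e) x /\ 0 < slope x e a /\ (2 <= a -> 1 / 2 <= slope x e a).
Proof.
  intros H Ha. pose proof (slope_nonzero x e a H ltac:(lra)) as Hs.
  pose proof (slope_denominator x e a H) as D.
  set (v := (x + a * e)%V) in *.
  assert (Hn : B v x + a * B v e = `|v| * `|v|).
  { rewrite <- Bself. unfold v at 4. now rewrite Badd, Bscal. }
  pose proof (form_le v x) as Vx. pose proof (form_le v e) as Ve.
  pose proof (form_le e v) as Ev. pose proof (form_le x v) as Xv.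
  replace v with (1 * x + a * e)%V in Ev at 1 by (unfold v; vring).
  replace v with (1 * x + a * e)%V in Xv at 1 by (unfold v; vring).
  rewrite orthonormal_coord_r in Ev by auto. rewrite orthonormal_coord_l in Xv by auto.
  pose proof H as (Hx & He & _). rewrite Hx in *. rewrite He in *.
  assert (P1 : 0 < B v x) by (assert (0 <= B v x) by nra; lra).
  assert (P2 : 0 <= B v e) by (apply (Rmult_le_reg_l a); nra).
  assert (S : slope x e a * B v x = B v e) by (unfold slope; fold v; field; auto).
  split; [auto|split].
  - assert (0 <= slope x e a); [|lra].
    apply (Rmult_le_reg_r (B v x)); lra.
  - intros Ha2. apply (Rmult_le_reg_r (B v x)); auto. rewrite S.
    apply (Rmult_le_reg_l a); auto. nra.
Qed.

End WithForm.
End Form.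

(** * Two functional inequalities on the real line *)

Section RealFunctions.

(** The normalized [m = M12 / M12 1] is multiplicative, satisfies [m (m a) = a] for positive [a],
    and is monotone there; a monotone involution is the identity. *)
Lemma multiplicative_involution_linear (M12 M13 M23 : R -> R) :
  (forall b, b <> 0 -> M12 b <> 0) -> (forall b, b <> 0 -> M23 b <> 0) ->
  (forall b c, b <> 0 -> M13 c = M23 (c / b) * M12 b) ->
  (forall a, a <> 0 -> M12 (- 1 / M12 a) = - 1 / a) ->
  0 < M12 1 -> (forall a, 2 <= a -> 1 / 2 <= M12 a) ->
  forall a, 0 < a -> M12 a = M12 1 * a.
Proof.
  intros nz12 nz23 Hcomp Hinv Hpos Hlow.
  pose (m := fun b => M12 b / M12 1).
  assert (HM : forall b, M12 b = M12 1 * m b) by (intros b; unfold m; field; lra).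
  assert (n23 : M23 1 <> 0) by (apply nz23; lra).
  assert (H23 : forall b, b <> 0 -> M23 b = M23 1 * m b).
  { intros b Hb. pose proof (Hcomp 1 b ltac:(lra)) as E1. pose proof (Hcomp b b Hb) as E2.
    replace (b / 1) with b in E1 by field. replace (b / b) with 1 in E2 by (field; auto).
    unfold m. field_simplify_eq; lra. }
  assert (m1 : m 1 = 1) by (unfold m; field; lra).
  assert (mmul : forall x b, x <> 0 -> b <> 0 -> m (x * b) = m x * m b).
  { intros x b Hx Hb.
    assert (Hxb : x * b <> 0) by now apply Rmult_integral_contrapositive_currified.
    pose proof (Hcomp 1 (x * b) ltac:(lra)) as E1. pose proof (Hcomp b (x * b) Hb) as E2.
    replace (x * b / 1) with (x * b) in E1 by field.
    replace (x * b / b) with x in E2 by (field; auto).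
    rewrite (H23 _ Hxb) in E1. rewrite (H23 _ Hx), (HM b) in E2.
    apply (Rmult_eq_reg_l (M23 1 * M12 1));
      [|apply Rmult_integral_contrapositive_currified; lra].
    lra. }
  assert (mnz : forall b, b <> 0 -> m b <> 0).
  { intros b Hb H0. apply (nz12 b Hb). rewrite HM, H0. ring. }
  assert (mpos : forall a, 0 < a -> 0 < m a).
  { intros a Ha. pose proof (sqrt_lt_R0 a Ha) as Hs.
    rewrite <- (sqrt_sqrt a) by lra. rewrite mmul by lra.
    pose proof (mnz (sqrt a) ltac:(lra)). nra. }
  (* The involution identity for [M12] holds for [m] up to a constant, which the case [a = 1]
     eliminates. *)
  assert (mm : forall a, 0 < a -> m (m a) = a).
  { assert (E : forall a, 0 < a -> M12 1 * m (-1) * a = - (m (M12 1) * m (m a))).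
    { intros a Ha. pose proof (mpos a Ha) as Hma.
      assert (Hden : M12 1 * m a <> 0) by nra.
      pose proof (Hinv a ltac:(lra)) as E. rewrite (HM a) in E.
      rewrite HM in E.
      replace (- 1 / (M12 1 * m a)) with ((-1) * / (M12 1 * m a)) in E by (field; nra).
      rewrite mmul in E by (try lra; now apply Rinv_neq_0_compat).
      assert (E2 : m (/ (M12 1 * m a)) * (m (M12 1) * m (m a)) = 1).
      { rewrite <- (mmul (M12 1) (m a)) by lra.
        rewrite <- mmul by (auto; now apply Rinv_neq_0_compat).
        rewrite Rinv_l by auto. exact m1. }
      assert (E3 : M12 1 * m (-1) * a * m (/ (M12 1 * m a)) = -1).
      { apply (f_equal (fun r => r * a)) in E.
        replace (- 1 / a * a) with (-1) in E by (field; lra). lra. }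
      pose proof (f_equal (fun r => r * (m (M12 1) * m (m a))) E3) as E4. simpl in E4.
      assert (E5 : M12 1 * m (-1) * a * (m (/ (M12 1 * m a)) * (m (M12 1) * m (m a)))
                   = - 1 * (m (M12 1) * m (m a))) by (rewrite <- E4; ring).
      rewrite E2 in E5. lra. }
    intros a Ha. pose proof (E a Ha) as Ea. pose proof (E 1 ltac:(lra)) as E1.
    rewrite !m1 in E1. pose proof (mpos _ Hpos).
    apply (Rmult_eq_reg_l (m (M12 1))); [|lra]. nra. }
  (* If [m a < 1], the powers [m (a ^ n) = m a ^ n] tend to 0, although [M12] stays above 1/2 at
     large arguments. *)
  assert (mge1 : forall a, 1 < a -> 1 <= m a).
  { intros a Ha. apply Rnot_lt_le. intros Hlt. pose proof (mpos a ltac:(lra)) as Hma.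
    assert (mpow : forall n, m (a ^ n) = m a ^ n).
    { induction n as [|n IH]; simpl; auto. rewrite mmul, IH; [reflexivity|lra|].
      apply pow_nonzero. lra. }
    destruct (Pow_x_infinity a ltac:(rewrite Rabs_pos_eq; lra) 2) as (N1 & HN1).
    destruct (pow_lt_1_zero (m a) ltac:(rewrite Rabs_pos_eq; lra) (1 / (2 * M12 1)))
      as (N2 & HN2).
    { apply Rdiv_lt_0_compat; lra. }
    set (n := Nat.max N1 N2).
    specialize (HN1 n ltac:(lia)). specialize (HN2 n ltac:(lia)).
    rewrite Rabs_pos_eq in HN1 by (apply pow_le; lra).
    rewrite Rabs_pos_eq in HN2 by (apply pow_le; lra).
    pose proof (Hlow (a ^ n) ltac:(lra)) as H. rewrite HM, mpow in H.
    apply (Rmult_lt_compat_l (M12 1)) in HN2; auto.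
    replace (M12 1 * (1 / (2 * M12 1))) with (1 / 2) in HN2 by (field; lra). lra. }
  assert (mmono : forall a b, 0 < a -> a < b -> m a <= m b).
  { intros a b Ha Hab. replace b with (b / a * a) by (field; lra).
    assert (1 < b / a).
    { apply (Rmult_lt_reg_r a); auto. unfold Rdiv. rewrite Rmult_assoc, Rinv_l; lra. }
    rewrite mmul by lra. pose proof (mge1 (b / a) H). pose proof (mpos a Ha). nra. }
  intros a Ha. rewrite HM. f_equal.
  pose proof (mm a Ha) as Hmm. pose proof (mpos a Ha) as Hma.
  destruct (Rtotal_order (m a) a) as [h|[h|h]]; auto.
  - pose proof (mmono (m a) a Hma h). lra.
  - pose proof (mmono a (m a) Ha h). lra.
Qed.

(** Over [n] equal steps the relative losses [K (A / n)^2] add up to [K A^2 / n], which tends to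
    0. *)
Lemma almost_monotone_le (D : R -> R) (K A : R) :
  0 <= K -> 0 <= A -> (forall t, 0 <= t <= A -> 0 < D t) ->
  (forall s t, 0 <= s <= A -> 0 <= t <= A -> D s * (1 - K * (s - t) ^ 2) <= D t) ->
  D 0 <= D A.
Proof.
  intros HK HA Hpos Hstep.
  pose proof (Hpos 0 ltac:(lra)) as H0.
  assert (Hn : forall n : nat, (0 < n)%nat -> K * A ^ 2 <= INR n ->
            D 0 * (1 - K * A ^ 2 / INR n) <= D A).
  { intros n Hn HKn. pose proof (lt_0_INR n Hn) as Hnpos.
    set (eps := K * A ^ 2 / INR n ^ 2).
    assert (He : 0 <= eps).
    { unfold eps, Rdiv. apply Rmult_le_pos; [nra|]. left. apply Rinv_0_lt_compat. nra. }
    assert (Hne : INR n * eps = K * A ^ 2 / INR n) by (unfold eps; field; lra).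
    assert (Hne1 : INR n * eps <= 1).
    { rewrite Hne. apply (Rmult_le_reg_r (INR n)); auto.
      unfold Rdiv. rewrite Rmult_assoc, Rinv_l; lra. }
    assert (Hi : forall i, (i <= n)%nat -> D 0 * (1 - INR i * eps) <= D (INR i * (A / INR n))).
    { assert (Hq : 0 <= A / INR n).
      { unfold Rdiv. apply Rmult_le_pos; auto. left. now apply Rinv_0_lt_compat. }
      assert (HAn : INR n * (A / INR n) = A) by (field; lra).
      induction i as [|i IH]; intros Hi.
      - simpl. rewrite !Rmult_0_l. lra.
      - specialize (IH ltac:(lia)).
        assert (Hi1 : INR i + 1 <= INR n) by (rewrite <- S_INR; apply le_INR; lia).
        pose proof (pos_INR i).
        pose proof (Hstep (INR i * (A / INR n)) (INR (S i) * (A / INR n))) as H1.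
        rewrite S_INR in *.
        replace (K * (INR i * (A / INR n) - (INR i + 1) * (A / INR n)) ^ 2) with eps in H1
          by (unfold eps; field; lra).
        assert (H2 : D (INR i * (A / INR n)) * (1 - eps) <= D ((INR i + 1) * (A / INR n)))
          by (apply H1; nra).
        assert (eps <= 1) by nra.
        assert (D 0 * (1 - INR i * eps) * (1 - eps) <= D (INR i * (A / INR n)) * (1 - eps))
          by (apply Rmult_le_compat_r; lra).
        assert (Hie : 0 <= INR i * eps) by (apply Rmult_le_pos; lra).
        assert (0 <= INR i * eps * eps) by (apply Rmult_le_pos; lra).
        assert (0 <= D 0 * (INR i * eps * eps)) by (apply Rmult_le_pos; lra).
        nra. }
    specialize (Hi n ltac:(lia)). rewrite Hne in Hi.
    replace (INR n * (A / INR n)) with A in Hi by (field; lra). exact Hi. }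
  apply le_epsilon. intros e He.
  destruct (INR_unbounded (K * A ^ 2 + D 0 * (K * A ^ 2) / e)) as (n & HN).
  assert (P : 0 <= D 0 * (K * A ^ 2) / e).
  { unfold Rdiv. apply Rmult_le_pos; [|left; now apply Rinv_0_lt_compat].
    apply Rmult_le_pos; nra. }
  assert (PK : 0 <= K * A ^ 2) by nra.
  assert (Hn0 : (0 < n)%nat) by (apply INR_lt; simpl; lra).
  specialize (Hn n Hn0 ltac:(lra)). pose proof (lt_0_INR n Hn0).
  assert (D 0 * (K * A ^ 2 / INR n) <= e); [|lra].
  apply (Rmult_le_reg_r (INR n)); auto.
  replace (D 0 * (K * A ^ 2 / INR n) * INR n) with (D 0 * (K * A ^ 2)) by (field; lra).
  apply Rle_trans with (e * (D 0 * (K * A ^ 2) / e)); [right; field; lra|].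
  apply Rmult_le_compat_l; lra.
Qed.

Lemma almost_monotone_eq (D : R -> R) (K A : R) :
  0 <= K -> 0 <= A -> (forall t, 0 <= t <= A -> 0 < D t) ->
  (forall s t, 0 <= s <= A -> 0 <= t <= A -> D s * (1 - K * (s - t) ^ 2) <= D t) ->
  D A = D 0.
Proof.
  intros HK HA Hpos Hstep. apply Rle_antisym.
  - pose proof (almost_monotone_le (fun t => D (A - t)) K A HK HA) as H.
    cbv beta in H.
    replace (A - 0) with A in H by ring. replace (A - A) with 0 in H by ring.
    apply H.
    + intros t Ht. apply Hpos. lra.
    + intros s t Hs Ht.
      replace (s - t) with (- ((A - s) - (A - t))) by ring.
      replace ((- ((A - s) - (A - t))) ^ 2) with (((A - s) - (A - t)) ^ 2) by ring.
      apply Hstep; lra.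
  - now apply (almost_monotone_le D K A).
Qed.

(** The last hypothesis encodes the logarithmic derivative [c s / (1 + c s^2)] of [N]. The quotient
    [D] of [N t ^ 2] by [1 + c t^2] then falls only to second order between any two points, so it is
    constant. *)
Lemma norm_profile_quadratic (N : R -> R) (c : R) :
  0 < c -> N 0 = 1 -> (forall t, 0 <= t -> 0 < N t) ->
  (forall s t, 0 <= s -> 0 <= t -> N s * (1 + c * s * t) <= N t * (1 + c * s * s)) ->
  forall t, 0 <= t -> N t * N t = 1 + c * t * t.
Proof.
  intros Hc H0 Hpos Hstep t Ht.
  assert (Hq : forall s, 0 < 1 + c * s * s) by (intros s; nra).
  pose (D := fun s => N s * N s / (1 + c * s * s)).
  assert (HD : D t = D 0).
  { apply (almost_monotone_eq D c t); auto; [lra| |].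
    - intros s Hs. unfold D. apply Rdiv_lt_0_compat; auto.
      pose proof (Hpos s ltac:(lra)). nra.
    - intros s r Hs Hr. pose proof (Hstep s r ltac:(lra) ltac:(lra)) as H.
      pose proof (Hpos s ltac:(lra)) as Hs'. pose proof (Hpos r ltac:(lra)) as Hr'.
      pose proof (Hq s) as Qs. pose proof (Hq r) as Qr.
      assert (H2 : (N s * (1 + c * s * r)) * (N s * (1 + c * s * r)) <=
                   (N r * (1 + c * s * s)) * (N r * (1 + c * s * s))).
      { assert (0 <= c * s * r) by (repeat apply Rmult_le_pos; lra).
        apply Rmult_le_compat; auto; apply Rmult_le_pos; lra. }
      unfold D. apply (Rmult_le_reg_r ((1 + c * r * r) * (1 + c * s * s) * (1 + c * s * s))).
      { repeat apply Rmult_lt_0_compat; auto. }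
      replace (N r * N r / (1 + c * r * r) * ((1 + c * r * r) * (1 + c * s * s) * (1 + c * s * s)))
        with ((N r * (1 + c * s * s)) * (N r * (1 + c * s * s))) by (field; lra).
      apply Rle_trans with (2 := H2).
      replace (N s * N s / (1 + c * s * s) * (1 - c * (s - r) ^ 2) *
               ((1 + c * r * r) * (1 + c * s * s) * (1 + c * s * s)))
        with (N s * N s * ((1 - c * (s - r) ^ 2) * ((1 + c * r * r) * (1 + c * s * s))))
        by (field; lra).
      replace (N s * (1 + c * s * r) * (N s * (1 + c * s * r)))
        with (N s * N s * ((1 + c * s * r) * (1 + c * s * r))) by ring.
      apply Rmult_le_compat_l; [nra|].
      (* (1+csr)^2 = (1+cr^2)(1+cs^2) - c(s-r)^2, and both factors are at least 1 *)
      assert (1 <= (1 + c * r * r) * (1 + c * s * s)) by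
        (assert (0 <= c * r * r) by (repeat apply Rmult_le_pos; lra);
         assert (0 <= c * s * s) by (repeat apply Rmult_le_pos; lra); nra).
      assert (0 <= c * (s - r) ^ 2) by (apply Rmult_le_pos; [lra|apply pow2_ge_0]).
      nra. }
  unfold D in HD. rewrite H0 in HD.
  replace (1 * 1 / (1 + c * 0 * 0)) with 1 in HD by field.
  apply (f_equal (fun r => r * (1 + c * t * t))) in HD.
  specialize (Hq t). replace (N t * N t / (1 + c * t * t) * (1 + c * t * t)) with (N t * N t) in HD
    by (field; lra). lra.
Qed.

End RealFunctions.

(** * Pythagoras' identity *)

Section Pythagoras.
Context {X : Banach} (B : X -> X -> R).
Hypothesis HB : duality_form B.
Implicit Types x y z e p q v w : X.

Let Badd v w w' : B v (w + w')%V = B v w + B v w'.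
Proof. apply HB. Qed.
Let Bscal v a w : B v (a * w)%V = a * B v w.
Proof. apply HB. Qed.
Let Bself v : B v v = `|v| * `|v|.
Proof. apply HB. Qed.

Definition pythagorean x e : Prop :=
  forall a b, `|a * x + b * e| * `|a * x + b * e| = a * a + b * b.

(** The third vector makes the slope linear, equal to [c a]; the support inequalities of [B]
    integrate this to [1 + c t^2], and growth at infinity gives [c = 1]. *)
Lemma third_vector_quadratic x y e :
  orthonormal B x y -> orthonormal B x e -> orthonormal B y e ->
  forall t, 0 <= t -> `|x + t * y| * `|x + t * y| = 1 + t * t.
Proof.
  intros Hxy Hxe Hye.
  set (c := slope B x y 1).
  assert (Hc : 0 < c) by (apply (slope_bounds B HB x y 1 Hxy); lra).
  assert (Hlin : forall a, 0 < a -> slope B x y a = c * a).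
  { apply (multiplicative_involution_linear _ (slope B x e) (slope B y e)); auto.
    - intros b Hb. now apply slope_nonzero.
    - intros b Hb. now apply slope_nonzero.
    - intros b d Hb. now apply slope_compose.
    - intros a Ha. now apply slope_involution.
    - intros a Ha. apply (slope_bounds B HB x y a Hxy); lra. }
  pose proof Hxy as (Hx & Hy & Hxy0).
  assert (Hdir : forall s, 0 <= s -> 0 < B (x + s * y) x /\
            B (x + s * y) y = c * s * B (x + s * y) x).
  { intros s [Hs|<-].
    - destruct (slope_bounds B HB x y s Hxy Hs) as (P & _). split; auto.
      rewrite <- (Hlin s Hs). unfold slope. field. lra.
    - replace (x + 0 * y)%V with x by vring. rewrite Hxy0, Bself, Hx. lra. }
  assert (Hlow : forall s, 1 <= `|x + s * y|).
  { intros s. pose proof (form_zero_orthogonal B HB x y (- s) Hxy0) as H.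
    replace (x - (- s) * y)%V with (x + s * y)%V in H by vring. lra. }
  assert (Hquad : forall t, 0 <= t -> `|x + t * y| * `|x + t * y| = 1 + c * t * t).
  { apply (norm_profile_quadratic (fun t => `|x + t * y|) c); auto.
    - replace (x + 0 * y)%V with x by vring. exact Hx.
    - intros t _. specialize (Hlow t). lra.
    - intros s t Hs Ht. destruct (Hdir s Hs) as (P & E).
      pose proof (Bself (x + s * y)%V) as E2.
      rewrite Badd, Bscal, E in E2.
      pose proof (form_le B HB (x + s * y) (x + t * y)) as H.
      rewrite Badd, Bscal, E in H.
      set (N := `|x + s * y|) in *. pose proof (Hlow s) as HN. fold N in HN.
      set (M := `|x + t * y|) in *. set (r := B (x + s * y) x) in *.
      apply (Rmult_le_reg_l (N * r)); [nra|].
      assert (N * N * (r * (1 + c * s * t)) <= N * M * (N * N)).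
      { replace (N * M * (N * N)) with (N * N * (N * M)) by ring.
        apply Rmult_le_compat_l; nra. }
      rewrite <- E2 in H0 at 2.
      replace (N * r * (N * (1 + c * s * t))) with (N * N * (r * (1 + c * s * t))) by ring.
      eapply Rle_trans; [exact H0|]. right. ring. }
  assert (Hup : forall t, 0 <= t -> `|x + t * y| <= 1 + t).
  { intros t Ht. pose proof (norm_triangle _ x (t * y)%V) as H.
    rewrite norm_scal, Rabs_pos_eq, Hx, Hy in H by auto. lra. }
  assert (Hlow2 : forall t, 0 <= t -> t <= `|x + t * y|).
  { intros t Ht. pose proof (form_le B HB y (x + t * y)) as H.
    replace (x + t * y)%V with (1 * x + t * y)%V in H at 1 by vring.
    rewrite orthonormal_coord_r, Hy in H by auto. lra. }
  (* For [c < 1] the chosen [t] violates [t <= |x + t y|]; for [c > 1] it violates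
     [|x + t y| <= 1 + t]. *)
  assert (c = 1) as Hc1.
  { destruct (Rtotal_order c 1) as [h|[h|h]]; auto; exfalso.
    - set (t := 2 / (1 - c)).
      assert (Ht : 2 <= t /\ t * (1 - c) = 2).
      { split; [|unfold t; field; lra].
        apply (Rmult_le_reg_r (1 - c)); [lra|]. unfold t.
        replace (2 / (1 - c) * (1 - c)) with 2 by (field; lra). nra. }
      pose proof (Hquad t ltac:(lra)). pose proof (Hlow2 t ltac:(lra)). nra.
    - set (t := 3 / (c - 1)).
      assert (Ht : 0 < t /\ t * (c - 1) = 3).
      { split; [apply Rdiv_lt_0_compat; lra|unfold t; field; lra]. }
      pose proof (Hquad t ltac:(lra)). pose proof (Hup t ltac:(lra)).
      pose proof (Hlow t). nra. }
  intros t Ht. rewrite Hquad, Hc1 by auto. ring.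
Qed.

Lemma pythagorean_of_third x y e :
  orthonormal B x y -> orthonormal B x e -> orthonormal B y e -> pythagorean x y.
Proof.
  intros Hxy Hxe Hye a b. pose proof Hxy as (Hx & Hy & _).
  assert (Hall : forall t, `|x + t * y| * `|x + t * y| = 1 + t * t).
  { intros t. destruct (Rle_lt_dec 0 t) as [h|h].
    - now apply (third_vector_quadratic x y e).
    - replace (x + t * y)%V with (x + (- t) * opp y)%V by vring.
      rewrite (third_vector_quadratic x (opp y) e); try lra; auto.
      + now apply orthonormal_opp.
      + apply orthonormal_sym; auto. apply orthonormal_opp; auto.
        now apply orthonormal_sym. }
  destruct (Req_dec a 0) as [->|Ha].
  - rewrite (norm_eq_scal _ b y) by vring. rewrite Hy, Rmult_1_r, <- Rabs_mult.
    rewrite Rabs_pos_eq; nra.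
  - rewrite (norm_eq_scal _ a (x + (b / a) * y)) by (vreduce; field; auto).
    replace (Rabs a * `|x + b / a * y| * (Rabs a * `|x + b / a * y|))
      with (Rabs (a * a) * (`|x + b / a * y| * `|x + b / a * y|))
      by (rewrite Rabs_mult; ring).
    rewrite Hall, Rabs_pos_eq by nra. field. auto.
Qed.

Definition spanning x e : Prop := forall v, v = (B x v * x + B e v * e)%V.

Lemma third_vector_or_spanning x y :
  orthonormal B x y ->
  (exists e, orthonormal B x e /\ orthonormal B y e) \/ spanning x y.
Proof.
  intros Hxy. destruct (classic (spanning x y)) as [h|h]; auto. left.
  apply not_all_ex_not in h. destruct h as [v Hv].
  set (w := (v - (B x v * x + B y v * y))%V).
  assert (Hw : 0 < `|w|).
  { apply norm_pos. intros H0. apply Hv.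
    replace v with (w + (B x v * x + B y v * y))%V at 1 by (unfold w; vring).
    rewrite H0. vring. }
  pose proof Hxy as (Hx & _). pose proof (orthonormal_sym B HB _ _ Hxy) as (Hy & _).
  exists (/ `|w| * w)%V. pose proof (norm_normalize w Hw).
  split; split; auto; split; auto; rewrite Bscal; unfold w at 2;
    rewrite (form_sub B HB).
  - rewrite orthonormal_coord_l by auto. ring.
  - rewrite orthonormal_coord_r by auto. ring.
Qed.

Lemma pythagorean_transfer p q x e :
  orthonormal B p q -> spanning p q -> pythagorean p q -> orthonormal B x e ->
  pythagorean x e.
Proof.
  intros Hpq Hspan Hpyth (Hx & He & Hxe) a b.
  rewrite (Hspan x), (Hspan e).
  assert (N : forall v, `|v| * `|v| = B p v * B p v + B q v * B q v)
    by (intros v; rewrite (Hspan v) at 1 2; apply Hpyth).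
  pose proof (N x) as Nx. pose proof (N e) as Ne. rewrite Hx in Nx. rewrite He in Ne.
  set (x1 := B p x) in *. set (x2 := B q x) in *.
  set (e1 := B p e) in *. set (e2 := B q e) in *.
  (* The Euclidean inner product of [x] and [e]: [x - d e] has squared norm [1 - d^2], and
     orthogonality forbids a value below 1. *)
  set (d := x1 * e1 + x2 * e2).
  assert (Hd : d = 0).
  { pose proof (form_zero_orthogonal B HB x e d Hxe) as H.
    pose proof (N (x - d * e)%V) as H1.
    rewrite !(form_sub B HB), !Bscal in H1. fold x1 x2 e1 e2 in H1.
    replace ((x1 - d * e1) * (x1 - d * e1) + (x2 - d * e2) * (x2 - d * e2))
      with ((x1 * x1 + x2 * x2) - 2 * d * d + d * d * (e1 * e1 + e2 * e2)) in H1
      by (unfold d; ring).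
    rewrite <- Nx, <- Ne in H1. rewrite Hx in H. nra. }
  replace (a * (x1 * p + x2 * q) + b * (e1 * p + e2 * q))%V
    with ((a * x1 + b * e1) * p + (a * x2 + b * e2) * q)%V by vring.
  rewrite Hpyth. unfold d in Hd.
  replace ((a * x1 + b * e1) * (a * x1 + b * e1) + (a * x2 + b * e2) * (a * x2 + b * e2))
    with (a * a * (x1 * x1 + x2 * x2) + b * b * (e1 * e1 + e2 * e2) +
          2 * a * b * (x1 * e1 + x2 * e2)) by ring.
  rewrite <- Nx, <- Ne, Hd. ring.
Qed.

(** * The two-dimensional case *)

Section Plane.
Hypothesis Huc : uniformly_convex X.
Hypothesis Htrans : forall x y eps, `|x| = 1 -> `|y| = 1 -> 0 < eps ->
  exists T, is_surj_lin_isometry X T /\ `|T x - y| < eps.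

Lemma isometry_almost_exchange x e eta :
  orthonormal B x e -> spanning x e -> 0 < eta ->
  exists T, is_surj_lin_isometry X T /\ `|T x - e| < eta /\
    (`|T e - x| < eta \/ `|T e + x| < eta).
Proof.
  intros Hxe Hspan Heta. pose proof Hxe as (Hx & He & Hxe0).
  destruct (Huc (eta / 2)) as (d & Hd & H); [lra|].
  destruct (Htrans x e (Rmin eta (d / 2)) Hx He) as (T & HT & HTx).
  { apply Rmin_glb_lt; lra. }
  pose proof (Rmin_l eta (d / 2)). pose proof (Rmin_r eta (d / 2)).
  exists T. split; [auto|split; [lra|]].
  pose proof HT as ((Tadd & Tscal) & Tnorm & _).
  set (b := B e (T e)). set (a := B x (T e)).
  assert (Hb1 : Rabs b <= 1).
  { unfold b. eapply Rle_trans; [apply HB|]. rewrite Tnorm, He. lra. }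
  (* The image of [e - b x], which is no shorter than [e], is almost [T e - b e]. *)
  assert (Hlow : 1 - d / 2 <= `|T e - b * e|).
  { pose proof (form_zero_orthogonal B HB e x b (form_zero_sym B HB _ _ Hxe0)) as H2.
    rewrite <- (Tnorm (e - b * x)%V), isometry_sub, Tscal, He in H2 by auto.
    pose proof (norm_le_add (T e - b * T x) (T e - b * e) ((- b) * (T x - e)) ltac:(vring)) as H3.
    rewrite norm_scal, Rabs_Ropp in H3.
    pose proof (norm_nonneg _ (T x - e)%V). pose proof (Rabs_pos b). nra. }
  assert (Hort : forall t, `|T e - b * e| <= `|T e - t * e|).
  { intros t. pose proof (form_zero_orthogonal B HB (T e - b * e) e (t - b)) as H2.
    replace ((T e - b * e) - (t - b) * e)%V with (T e - t * e)%V in H2 by vring.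
    apply H2. apply (form_zero_sym B HB). rewrite (form_sub B HB), Bscal, Bself, He.
    fold b. ring. }
  (* [T e] and its residual along [e] have norm almost 1, and so has their midpoint; uniform
     convexity makes their difference [b e] small. *)
  assert (Hbsmall : Rabs b < eta / 2).
  { assert (H2 : `|T e - (T e - b * e)| < eta / 2).
    { apply H.
      - rewrite Tnorm. lra.
      - pose proof (Hort 0) as H3. replace (T e - 0 * e)%V with (T e) in H3 by vring.
        rewrite Tnorm in H3. lra.
      - rewrite (norm_eq_scal (T e + (T e - b * e)) 2 (T e - (b / 2) * e)) by (vreduce; field).
        rewrite Rabs_pos_eq by lra. specialize (Hort (b / 2)). lra. }
    rewrite (norm_eq_scal _ b e), He in H2 by vring. lra. }
  assert (HTe : T e = (a * x + b * e)%V) by apply Hspan.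
  assert (Ha : Rabs (1 - Rabs a) <= Rabs b).
  { pose proof (norm_le_add (T e) (a * x) (b * e) HTe) as H2.
    pose proof (norm_le_add (a * x) (T e) ((- b) * e) ltac:(rewrite HTe; vring)) as H3.
    rewrite Tnorm, !norm_scal, Hx, He in H2. rewrite Tnorm, !norm_scal, Rabs_Ropp, Hx, He in H3.
    apply Rabs_le. lra. }
  destruct (Rle_lt_dec 0 a) as [h|h].
  - left. rewrite (Rabs_pos_eq a) in Ha by auto.
    pose proof (norm_le_add (T e - x) ((a - 1) * x) (b * e) ltac:(rewrite HTe; vring)) as H2.
    rewrite !norm_scal, Hx, He, (Rabs_minus_sym a 1) in H2. lra.
  - right. rewrite (Rabs_left a) in Ha by auto.
    pose proof (norm_le_add (T e + x) ((1 - - a) * x) (b * e) ltac:(rewrite HTe; vring)) as H2.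
    rewrite !norm_scal, Hx, He in H2. lra.
Qed.

Definition swap_invariant x e : Prop := forall a b, `|a * e + b * x| = `|a * x + b * e|.
Definition turn_invariant x e : Prop := forall a b, `|a * e - b * x| = `|a * x + b * e|.

Lemma image_norm_close (T : X -> X) x e x' e' a b eta :
  is_surj_lin_isometry X T -> `|T x - x'| < eta -> `|T e - e'| < eta ->
  Rabs (`|a * x' + b * e'| - `|a * x + b * e|) <= (Rabs a + Rabs b) * eta.
Proof.
  intros ((Tadd & Tscal) & Tnorm & _) Hx He.
  rewrite <- (Tnorm (a * x + b * e)%V), Tadd, !Tscal.
  set (v := (a * T x + b * T e)%V). set (v' := (a * x' + b * e')%V).
  assert (Hd : `|v - v'| <= (Rabs a + Rabs b) * eta).
  { pose proof (norm_le_add (v - v') (a * (T x - x')) (b * (T e - e'))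
      ltac:(unfold v, v'; vring)) as H.
    rewrite !norm_scal in H. pose proof (Rabs_pos a). pose proof (Rabs_pos b). nra. }
  pose proof (norm_le_add v' v (v' - v) ltac:(vring)) as H1.
  pose proof (norm_le_add v v' (v - v') ltac:(vring)) as H2.
  rewrite (norm_sub_comm v' v) in H1. apply Rabs_le. lra.
Qed.

(** If both invariances fail somewhere, an almost exchange with error below both normalized defects
    contradicts one of the failures. *)
Lemma swap_or_turn x e :
  orthonormal B x e -> spanning x e -> swap_invariant x e \/ turn_invariant x e.
Proof.
  intros Hxe Hspan. apply NNPP. intros Hn. apply not_or_and in Hn. destruct Hn as [Hs Ht].
  apply not_all_ex_not in Hs. destruct Hs as [a Hs].
  apply not_all_ex_not in Hs. destruct Hs as [b Hs].
  apply not_all_ex_not in Ht. destruct Ht as [a' Ht].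
  apply not_all_ex_not in Ht. destruct Ht as [b' Ht].
  set (g := Rabs (`|a * e + b * x| - `|a * x + b * e|)).
  set (g' := Rabs (`|a' * e - b' * x| - `|a' * x + b' * e|)).
  assert (Hg : 0 < g) by (apply Rabs_pos_lt; lra).
  assert (Hg' : 0 < g') by (apply Rabs_pos_lt; lra).
  (* The added 1 keeps [K] positive and makes the final comparison strict. *)
  set (K := Rabs a + Rabs b + 1). set (K' := Rabs a' + Rabs b' + 1).
  assert (HK : 0 < K) by (unfold K; pose proof (Rabs_pos a); pose proof (Rabs_pos b); lra).
  assert (HK' : 0 < K') by (unfold K'; pose proof (Rabs_pos a'); pose proof (Rabs_pos b'); lra).
  assert (Q : 0 < g / K) by now apply Rdiv_lt_0_compat.
  assert (Q' : 0 < g' / K') by now apply Rdiv_lt_0_compat.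
  assert (Heta : 0 < Rmin (g / K) (g' / K')) by now apply Rmin_glb_lt.
  destruct (isometry_almost_exchange x e _ Hxe Hspan Heta) as (T & HT & HTx & HTe).
  pose proof (Rmin_l (g / K) (g' / K')) as L1. pose proof (Rmin_r (g / K) (g' / K')) as L2.
  set (eta := Rmin (g / K) (g' / K')) in *.
  destruct HTe as [HTe|HTe].
  - pose proof (image_norm_close T x e e x a b eta HT HTx HTe) as H. fold g in H.
    apply (Rmult_le_compat_l K) in L1; [|lra].
    replace (K * (g / K)) with g in L1 by (field; lra). unfold K in L1. lra.
  - replace (T e + x)%V with (T e - opp x)%V in HTe by vring.
    pose proof (image_norm_close T x e e (opp x) a' b' eta HT HTx HTe) as H.
    replace (a' * e + b' * opp x)%V with (a' * e - b' * x)%V in H by vring. fold g' in H.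
    apply (Rmult_le_compat_l K') in L2; [|lra].
    replace (K' * (g' / K')) with g' in L2 by (field; lra). unfold K' in L2. lra.
Qed.

(** * Invariance of area in a plane *)

Section Area.
Variables x e : X.
Hypothesis Hxe : orthonormal B x e.
Hypothesis Hspan : spanning x e.

Let area p q : R := B x p * B e q - B e p * B x q.

Lemma area_bound p q : Rabs (area p q) <= 2 * (`|p| * `|q|).
Proof.
  destruct Hxe as (Hx & He & _).
  assert (Bx : forall v, Rabs (B x v) <= `|v|).
  { intros v. eapply Rle_trans; [apply HB|]. rewrite Hx. lra. }
  assert (Be : forall v, Rabs (B e v) <= `|v|).
  { intros v. eapply Rle_trans; [apply HB|]. rewrite He. lra. }
  unfold area, Rminus. eapply Rle_trans; [apply Rabs_triang|].
  rewrite Rabs_Ropp, !Rabs_mult.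
  assert (Rabs (B x p) * Rabs (B e q) <= `|p| * `|q|)
    by (apply Rmult_le_compat; auto using Rabs_pos).
  assert (Rabs (B e p) * Rabs (B x q) <= `|p| * `|q|)
    by (apply Rmult_le_compat; auto using Rabs_pos).
  lra.
Qed.

(** Multiplicativity of the determinant: [area (T x) (T e)] is the determinant of [T]. *)
Lemma area_isometry T p q :
  is_surj_lin_isometry X T -> area (T p) (T q) = area (T x) (T e) * area p q.
Proof.
  intros ((Tadd & Tscal) & _). unfold area.
  rewrite (Hspan p) at 1 2. rewrite (Hspan q) at 1 2.
  rewrite !Tadd, !Tscal, !Badd, !Bscal. ring.
Qed.

Lemma area_xe : area x e = 1.
Proof.
  destruct Hxe as (Hx & He & H0). unfold area. rewrite H0, !Bself, Hx, He. ring.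
Qed.

(* The supremum of [|area|] on pairs of unit vectors is preserved, hence [|det T| = 1]. *)
Lemma area_isometry_abs T p q :
  is_surj_lin_isometry X T -> Rabs (area (T p) (T q)) = Rabs (area p q).
Proof.
  intros HT. pose proof HT as ((Tadd & Tscal) & Tnorm & Tsurj).
  destruct Hxe as (Hx & He & H0).
  destruct (completeness (fun r => exists p q, `|p| = 1 /\ `|q| = 1 /\ r = Rabs (area p q)))
    as [sg [Hs1 Hs2]].
  { exists 2. intros r (p1 & q1 & Hp & Hq & ->). pose proof (area_bound p1 q1) as H.
    rewrite Hp, Hq in H. lra. }
  { exists (Rabs (area x e)). exists x, e. auto. }
  assert (Hsg : 1 <= sg).
  { apply Hs1. exists x, e. rewrite area_xe, Rabs_R1. auto. }
  set (D := Rabs (area (T x) (T e))).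
  assert (Hup : sg <= D * sg).
  { apply Hs2. intros r (p1 & q1 & Hp & Hq & ->).
    destruct (Tsurj p1) as [p2 <-]. destruct (Tsurj q1) as [q2 <-].
    rewrite area_isometry, Rabs_mult by auto. fold D.
    apply Rmult_le_compat_l; [apply Rabs_pos|]. apply Hs1.
    rewrite Tnorm in Hp, Hq. exists p2, q2. auto. }
  assert (HD : 1 <= D) by nra.
  assert (Hlow : sg <= / D * sg).
  { apply Hs2. intros r (p1 & q1 & Hp & Hq & ->).
    apply (Rmult_le_reg_l D); [lra|].
    rewrite <- Rmult_assoc, Rinv_r, Rmult_1_l by lra.
    unfold D. rewrite <- Rabs_mult, <- area_isometry by auto.
    apply Hs1. exists (T p1), (T q1). rewrite !Tnorm. auto. }
  assert (HD1 : D = 1).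
  { apply Rle_antisym; auto.
    apply (Rmult_le_compat_l D) in Hlow; [|lra].
    rewrite <- Rmult_assoc, Rinv_r, Rmult_1_l in Hlow by lra. nra. }
  rewrite area_isometry, Rabs_mult by auto. fold D. rewrite HD1. ring.
Qed.

(** For [v = x] the area is [B e w], and transitivity moves any [v] close to [x]. *)
Lemma area_le_one v w : `|v| = 1 -> `|w| = 1 -> Rabs (area v w) <= 1.
Proof.
  intros Hv Hw. apply le_epsilon. intros eps Heps. destruct Hxe as (Hx & He & H0).
  destruct (Htrans v x (eps / 2) Hv Hx) as (T & HT & HTv); [lra|].
  pose proof HT as (_ & Tnorm & _).
  rewrite <- (area_isometry_abs T) by auto.
  replace (area (T v) (T w)) with (B e (T w) + area (T v - x) (T w)).
  - eapply Rle_trans; [apply Rabs_triang|].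
    pose proof (area_bound (T v - x) (T w)) as H. rewrite Tnorm, Hw in H.
    assert (Rabs (B e (T w)) <= 1).
    { eapply Rle_trans; [apply HB|]. rewrite Tnorm, He, Hw. lra. }
    lra.
  - unfold area. rewrite !(form_sub B HB), Bself, Hx, (form_zero_sym B HB _ _ H0). ring.
Qed.

(** [w] is the preimage of [e] under an isometry that takes [v] close to [x]. *)
Lemma area_almost_one v eps :
  `|v| = 1 -> 0 < eps -> exists w, `|w| = 1 /\ 1 - eps <= Rabs (area v w).
Proof.
  intros Hv Heps. destruct Hxe as (Hx & He & H0).
  destruct (Htrans v x eps Hv Hx Heps) as (T & HT & HTv).
  pose proof HT as (_ & Tnorm & Tsurj). destruct (Tsurj e) as [w Hw].
  exists w. split; [rewrite <- Tnorm, Hw; auto|].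
  rewrite <- (area_isometry_abs T), Hw by auto.
  unfold area. rewrite H0, Bself, He.
  assert (Hb : Rabs (B x (T v - x)) <= `|T v - x|).
  { eapply Rle_trans; [apply HB|]. rewrite Hx. lra. }
  rewrite (form_sub B HB), Bself, Hx in Hb.
  eapply Rle_trans; [|apply Rle_abs].
  pose proof (Rle_abs (- (B x (T v) - 1 * 1))) as H1. rewrite Rabs_Ropp in H1. lra.
Qed.

(** A unit vector and its quarter turn span area [a^2 + b^2], so the unit sphere lies in the
    Euclidean disc. A partner [w] of area almost 1 also lies in that disc, and Cauchy-Schwarz puts
    [v] on the circle. *)
Lemma turn_invariant_pythagorean : turn_invariant x e -> pythagorean x e.
Proof.
  intros Hturn.
  assert (Hle : forall v, `|v| = 1 -> B x v * B x v + B e v * B e v <= 1).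
  { intros v Hv. set (a := B x v). set (b := B e v).
    assert (Hw : `|a * e - b * x| = 1).
    { rewrite Hturn. unfold a, b. rewrite <- (Hspan v). exact Hv. }
    pose proof (area_le_one v (a * e - b * x)%V Hv Hw) as H.
    pose proof (Rle_abs (area v (a * e - b * x)%V)) as H1.
    unfold area in H, H1. destruct Hxe as (Hx & He & H0).
    rewrite !(form_sub B HB), !Bscal, !Bself, Hx, He, H0, (form_zero_sym B HB _ _ H0) in H, H1.
    fold a b in H, H1. lra. }
  assert (Hge : forall v, `|v| = 1 -> 1 <= B x v * B x v + B e v * B e v).
  { intros v Hv. apply le_epsilon. intros eps Heps.
    assert (Hmin : 0 < Rmin 1 (eps / 2)) by (apply Rmin_glb_lt; lra).
    destruct (area_almost_one v (Rmin 1 (eps / 2)) Hv Hmin) as (w & Hw & H).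
    pose proof (Hle w Hw) as Hw1.
    pose proof (Rmin_l 1 (eps / 2)). pose proof (Rmin_r 1 (eps / 2)).
    set (d := Rmin 1 (eps / 2)) in *.
    assert (Hsq : (1 - d) * (1 - d) <= area v w * area v w).
    { assert (E : Rabs (area v w) * Rabs (area v w) = area v w * area v w)
        by (rewrite <- Rabs_mult; apply Rabs_pos_eq; nra).
      rewrite <- E. apply Rmult_le_compat; lra. }
    unfold area in Hsq.
    set (a := B x v) in *. set (b := B e v) in *. set (c := B x w) in *. set (r := B e w) in *.
    assert ((a * r - b * c) * (a * r - b * c) <= (a * a + b * b) * (c * c + r * r)).
    { assert (0 <= (a * c + b * r) * (a * c + b * r)) by apply Rle_0_sqr. lra. }
    nra. }
  assert (Hunit : forall v, `|v| * `|v| = B x v * B x v + B e v * B e v).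
  { intros v. destruct (classic (v = zero)) as [->|Hv].
    - replace (zero : X) with (0 * zero : X)%V by vring.
      rewrite !Bscal, norm_scal, Rabs_R0. ring.
    - apply norm_pos in Hv. pose proof (norm_normalize v Hv) as Hn.
      pose proof (Hle _ Hn) as H1. pose proof (Hge _ Hn) as H2.
      rewrite !Bscal in H1, H2.
      assert (E : / `|v| * B x v * (/ `|v| * B x v) + / `|v| * B e v * (/ `|v| * B e v) = 1) by lra.
      apply (f_equal (fun r => r * (`|v| * `|v|))) in E. rewrite Rmult_1_l in E.
      rewrite <- E. field. lra. }
  intros a b. rewrite Hunit, orthonormal_coord_l, orthonormal_coord_r by auto. reflexivity.
Qed.

End Area.

(** The swap is a reflection fixing [x + e] and negating [e - x]; the normalized diagonals [p] and
    [q] are the new axes. *)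
Lemma swap_invariant_diagonals x e :
  orthonormal B x e -> spanning x e -> swap_invariant x e ->
  exists p q, orthonormal B p q /\ spanning p q /\
    forall a b, `|a * p - b * q| = `|a * p + b * q|.
Proof.
  intros Hxe Hspan Hswap. pose proof Hxe as (Hx & He & H0).
  assert (Hn : 0 < `|x + e|).
  { apply norm_pos. intros E. assert (H : B x (x + e) = 1).
    { replace (x + e)%V with (1 * x + 1 * e)%V by vring. now apply orthonormal_coord_l. }
    rewrite E in H. replace (zero : X) with (0 * zero : X)%V in H by vring.
    rewrite Bscal in H. lra. }
  assert (Hn' : 0 < `|e - x|).
  { apply norm_pos. intros E. assert (H : B x (e - x) = -1).
    { replace (e - x)%V with ((-1) * x + 1 * e)%V by vring. now apply orthonormal_coord_l. }
    rewrite E in H. replace (zero : X) with (0 * zero : X)%V in H by vring.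
    rewrite Bscal in H. lra. }
  set (n := `|x + e|) in *. set (n' := `|e - x|) in *.
  set (p := (/ n * (x + e))%V). set (q := (/ n' * (e - x))%V).
  assert (Hp : `|p| = 1) by (now apply norm_normalize).
  assert (Hq : `|q| = 1) by (now apply norm_normalize).
  assert (Hrefl : forall a b, `|a * p - b * q| = `|a * p + b * q|).
  { intros a b.
    replace (a * p - b * q)%V
      with ((a * / n - b * / n') * e + (a * / n + b * / n') * x)%V by (unfold p, q; vring).
    rewrite Hswap. f_equal. unfold p, q. vring. }
  assert (Hpq : orthonormal B p q).
  (* By the reflection [q - t p] and [q + t p] have equal norm, and their sum is [2 q]. *)
  { split; [|split]; auto. apply HB. intros t.
    pose proof (Hrefl t 1) as E.
    replace (t * p - 1 * q)%V with ((-1) * (q - t * p))%V in E by vring.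
    rewrite (norm_scal _ (-1)), (Rabs_left (-1)) in E by lra.
    pose proof (norm_le_add (2 * q) (q - t * p) (t * p + 1 * q) ltac:(vring)) as H.
    rewrite norm_scal, Rabs_pos_eq in H by lra. lra. }
  exists p, q. split; [|split]; auto.
  intros v.
  assert (E : exists a b, v = (a * p + b * q)%V).
  { exists (n * (B x v + B e v) / 2), (n' * (B e v - B x v) / 2).
    rewrite (Hspan v) at 1. unfold p, q. vreduce; field; lra. }
  destruct E as (a & b & ->).
  now rewrite orthonormal_coord_l, orthonormal_coord_r.
Qed.

Lemma pythagorean_plane x e : orthonormal B x e -> spanning x e -> pythagorean x e.
Proof.
  intros Hxe Hspan. destruct (swap_or_turn x e Hxe Hspan) as [Hs|Ht];
    [|now apply turn_invariant_pythagorean].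
  destruct (swap_invariant_diagonals x e Hxe Hspan Hs) as (p & q & Hpq & Hspq & Hrefl).
  apply (pythagorean_transfer p q); auto.
  apply turn_invariant_pythagorean; auto.
  destruct (swap_or_turn p q Hpq Hspq) as [Hs'|]; auto.
  (* The swap of [p] and [q] composed with the reflection is a quarter turn. *)
  intros a b. rewrite <- Hs', add_comm, <- Hrefl, norm_sub_comm. reflexivity.
Qed.

Lemma orthonormal_pythagorean x e : orthonormal B x e -> pythagorean x e.
Proof.
  intros Hxe. destruct (third_vector_or_spanning x e Hxe) as [(z & H1 & H2)|Hs].
  - now apply (pythagorean_of_third x e z).
  - now apply pythagorean_plane.
Qed.

End Plane.

(** By Pythagoras the turned vector [- b x + a e] is Birkhoff-James orthogonal to [v], so [B v]
    annihilates it; the second argument is decomposed along these two. *)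
Lemma pythagorean_form x e a b c d :
  pythagorean x e -> B (a * x + b * e) (c * x + d * e) = a * c + b * d.
Proof.
  intros Hp. set (v := (a * x + b * e)%V).
  assert (Hperp : B v ((- b) * x + a * e) = 0).
  { apply HB. intros t. unfold v.
    replace (((- b) * x + a * e) - t * (a * x + b * e))%V
      with ((- b - t * a) * x + (a - t * b) * e)%V by vring.
    pose proof (Hp (- b) a) as E1. pose proof (Hp (- b - t * a) (a - t * b)) as E2.
    apply Rsqr_incr_0; try apply norm_nonneg. unfold Rsqr. rewrite E1, E2.
    assert (0 <= t * t * (a * a + b * b)) by (apply Rmult_le_pos; nra). lra. }
  pose proof (Bself v) as Hself. unfold v in Hself at 3 4. rewrite Hp in Hself.
  destruct (Req_dec (a * a + b * b) 0) as [h|h].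
  - assert (a = 0) by nra. assert (b = 0) by nra.
    assert (Hv : v = zero) by (unfold v; subst a b; vring).
    pose proof (proj1 (proj2 (proj2 (proj2 HB))) v (c * x + d * e)%V) as Hb.
    rewrite Hv, norm_zero, Rmult_0_l in Hb. rewrite Hv.
    destruct (Req_dec (B zero (c * x + d * e)) 0) as [E|E]; [subst; lra|].
    apply Rabs_pos_lt in E. lra.
  - replace (c * x + d * e)%V with
      (((a * c + b * d) / (a * a + b * b)) * v +
       ((a * d - b * c) / (a * a + b * b)) * ((- b) * x + a * e))%V
      by (unfold v; vreduce; field; auto).
    rewrite Badd, !Bscal, Hperp, Hself. field. auto.
Qed.

(** Both vectors lie in the span of an orthonormal pair, on which the form is the Euclidean one. *)
Lemma form_symmetric :
  (forall x e, orthonormal B x e -> pythagorean x e) -> forall v w, B v w = B w v.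
Proof.
  intros Hpyth v w.
  assert (Hzero : forall z, B zero z = 0).
  { intros z. apply (form_zero_sym B HB).
    replace (zero : X) with (0 * zero : X)%V by vring. rewrite Bscal. ring. }
  destruct (classic (v = zero)) as [->|Hv].
  { rewrite Hzero. symmetry. apply (form_zero_sym B HB), Hzero. }
  apply norm_pos in Hv. set (x := (/ `|v| * v)%V).
  assert (Hx : `|x| = 1) by now apply norm_normalize.
  assert (Ev : v = (`|v| * x)%V) by (unfold x; vreduce; field; lra).
  set (z := (w - B x w * x)%V).
  assert (Hxz : B x z = 0) by (unfold z; rewrite (form_sub B HB), Bscal, Bself, Hx; ring).
  assert (Ew : w = (B x w * x + z)%V) by (unfold z; vring).
  destruct (classic (z = zero)) as [Hz|Hz].
  (* Here [w] is parallel to [v] and supplies no second axis; both values follow from [Bself]. *)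
  - rewrite Hz, add_zero in Ew. set (l := B x w) in *. rewrite Ew.
    destruct (Req_dec l 0) as [->|Hl].
    { rewrite scal_zero_l, Hzero. apply (form_zero_sym B HB), Hzero. }
    rewrite Bscal.
    assert (E1 : B v x * `|v| = `|v| * `|v|) 
      by (rewrite Rmult_comm, <- Bscal, <- Ev; apply Bself).
    assert (E2 : l * B (l * x) x = l * l).
    { rewrite <- Bscal, Bself, norm_scal, Hx, Rmult_1_r, <- Rabs_mult.
      apply Rabs_pos_eq. nra. }
    assert (B v x = `|v|) by (apply (Rmult_eq_reg_r `|v|); lra).
    assert (B (l * x) x = l) by (apply (Rmult_eq_reg_l l); lra).
    rewrite Ev at 2. rewrite Bscal. nra.
  - apply norm_pos in Hz. set (e := (/ `|z| * z)%V).
    assert (Hxe : orthonormal B x e).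
    { split; [|split]; auto; [now apply norm_normalize|]. unfold e. rewrite Bscal, Hxz. ring. }
    assert (Ez : z = (`|z| * e)%V) by (unfold e; vreduce; field; lra).
    assert (Ev' : v = (`|v| * x + 0 * e)%V) by (rewrite Ev at 1; vring).
    assert (Ew' : w = (B x w * x + `|z| * e)%V) by (rewrite <- Ez; exact Ew).
    set (l := B x w) in *. set (n := `|v|) in *. set (k := `|z|) in *.
    rewrite Ev', Ew'. rewrite !(pythagorean_form x e) by auto. ring.
Qed.

End Pythagoras.

(** * Transitivity between arbitrary unit vectors and conclusion *)

Lemma isometry_inverse (X : Banach) (T : X -> X) :
  is_surj_lin_isometry X T ->
  exists S, is_surj_lin_isometry X S /\ forall x, S (T x) = x.
Proof.
  intros ((Tadd & Tscal) & Tnorm & Tsurj).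
  pose (S := fun y => proj1_sig (constructive_indefinite_description _ (Tsurj y))).
  assert (TS : forall y, T (S y) = y)
    by (intros y; unfold S; now destruct (constructive_indefinite_description _ (Tsurj y))).
  assert (Tinj : forall x y, T x = T y -> x = y).
  { intros x y E. assert (H : `|x + (-1) * y| = 0).
    { rewrite <- Tnorm, Tadd, Tscal, E.
      replace (T y + (-1) * T y)%V with (zero : X) by vring. apply norm_zero. }
    apply norm_eq_zero in H.
    replace x with ((x + (-1) * y) + y)%V by vring. rewrite H. vring. }
  exists S. split; [|intros x; apply Tinj, TS].
  split; [split|split].
  - intros x y. apply Tinj. now rewrite Tadd, !TS.
  - intros a x. apply Tinj. now rewrite Tscal, !TS.
  - intros x. now rewrite <- Tnorm, TS.
  - intros x. exists (T x). apply Tinj, TS.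
Qed.

Theorem theorem5p1 (X : Banach) (u : X) (P : X -> X) :
  convex_transitive X ->
  sphere_X X u ->
  (* P : X -> [u] is a linear projection *)
  is_linear X P ->
  (forall x, P (P x) = P x) ->
  (forall y, (exists x, P x = y) <-> (exists a, y = scal a u)) ->
  (* P bicontractive *)
  (forall x, norm (P x) <= norm x) ->
  (forall x, norm (sub X x (P x)) <= norm x) ->
  (* (i) weakly exposed points of B_X are norm-dense in S_X *)
  (forall y, sphere_X X y -> forall eps, 0 < eps ->
     exists x, weakly_exposed X x /\ norm (sub X x y) < eps) ->
  (* (ii) u o J is upper semi-continuous at u on (S_X, w) *)
  usc_weak_at X (uJ X u) u ->
  is_hilbert X.
Proof.
  intros Hct Hu HP HPP Hran HP1 HP2 Hdense Husc.
  destruct (projection_functional u P Hu HP HPP Hran HP1) as (f & Hf & HPf & Hfu & Hf1).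
  assert (Hbi : forall x, `|x - f x * u| <= `|x|) by (intros x; rewrite <- HPf; auto).
  assert (Huc : uniformly_convex X)
    by now apply (uniformly_convex_of_weakly_exposed u f).
  assert (Horb : forall x eps, `|x| = 1 -> 0 < eps ->
            exists T, is_surj_lin_isometry X T /\ `|T x - u| < eps)
    by (intros x eps Hx He; now apply (convex_transitive_dense_orbit u f)).
  assert (Htrans : forall x y eps, `|x| = 1 -> `|y| = 1 -> 0 < eps ->
            exists T, is_surj_lin_isometry X T /\ `|T x - y| < eps).
  { intros x y eps Hx Hy He.
    destruct (Horb x (eps / 2) Hx) as (T1 & HT1 & H1); [lra|].
    destruct (Horb y (eps / 2) Hy) as (T2 & HT2 & H2); [lra|].
    destruct (isometry_inverse X T2 HT2) as (S & HS & HST).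
    (* [T1 x] and [T2 y] both lie near [u], so the inverse of [T2] takes [T1 x] near [y]. *)
    exists (fun v => S (T1 v)). split.
    - destruct HT1 as ((A1 & S1) & N1 & R1). destruct HS as ((A2 & S2) & N2 & R2).
      split; [split|split].
      + intros v w. now rewrite A1, A2.
      + intros a v. now rewrite S1, S2.
      + intros v. now rewrite N2, N1.
      + intros v. destruct (R2 v) as [w <-]. destruct (R1 w) as [z <-]. eauto.
    - rewrite <- (HST y), <- isometry_sub by auto.
      destruct HS as (_ & N2 & _). rewrite N2.
      pose proof (norm_le_add (T1 x - T2 y) (T1 x - u) (u - T2 y) ltac:(vring)) as H.
      rewrite (norm_sub_comm u) in H. lra. }
  destruct (duality_form_exists Huc) as [B HB].
  { intros x Hx. apply (bicontractive_everywhere u f); auto.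
    split; [|split; [|split]]; auto. }
  assert (Hsym : forall v w, B v w = B w v).
  { apply form_symmetric; auto. intros x e Hxe. now apply (orthonormal_pythagorean B). }
  exists B. destruct HB as (Badd & Bscal & Bself & _ & _).
  split; [|split; [|split; [|split]]]; auto.
  - intros x y z. rewrite (Hsym _ z), Badd, (Hsym z x), (Hsym z y). reflexivity.
  - intros a x y. rewrite (Hsym _ y), Bscal, (Hsym y x). reflexivity.
  - intros x. rewrite Bself. pose proof (norm_nonneg _ x). nra.
  - intros x. rewrite Bself, sqrt_square; auto. apply norm_nonneg.
Qed.
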